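(* Let $\alpha$ be irrational. For any integer $K \ge 0$ and any integer $N$ with $q_K \le N < q_{K+1}$, \[ \sum_{n=1}^N \frac{1}{n \| n \alpha \|} = (\log N)^2 + \frac{\pi^2}{6} s_K + a_{K+1} \sum_{1 \le j \le N/q_K} \frac{1}{j^2} + O \left( \sum_{k=1}^{K+1} a_k^{1/2} \log a_k + (\log s_{K+1}) \log N \right) \] with a universal implied constant.
   Context: $\| x \|$ denotes the distance from $x$ to the nearest integer. $\alpha = [a_0; a_1, a_2, \ldots]$ is the continued fraction expansion of $\alpha$, with convergents $p_k/q_k = [a_0;a_1,\ldots,a_k]$ (so $q_0=1$), and $s_K = \sum_{k=1}^K a_k$. In error terms, $\log x$ means $\log \max\{e,x\}$. *)

(* Defs.v *)
From mathcomp Require Import all_boot all_order all_algebra.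
From mathcomp Require Import all_classical all_reals all_analysis.
Set Implicit Arguments.
Unset Strict Implicit.
Unset Printing Implicit Defensive.
Import Order.TTheory GRing.Theory Num.Theory.
Local Open Scope classical_set_scope.
Local Open Scope ring_scope.

Definition nearest_int_dist (R : realType) (x : R) : R :=
  inf [set `|x - m%:~R| | m in [set: int]].

(* For irrational x the inverse below is never taken at 0. *)
Definition complete_quotient (R : realType) (x : R) (k : nat) : R :=
  iter k (fun y => (y - (Num.floor y)%:~R)^-1) x.

Definition partial_quotient (R : realType) (x : R) (k : nat) : int :=
  Num.floor (complete_quotient x k).

(* cfrac a [:: b1; ...; bk] = [a; b1, ..., bk] *)
Fixpoint cfrac (a : int) (s : seq int) : rat :=
  if s is b :: s' then a%:~R + (cfrac b s')^-1 else a%:~R.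

Definition convergent (R : realType) (x : R) (k : nat) : rat :=
  cfrac (partial_quotient x 0)
        [seq partial_quotient x i | i <- iota 1 k].

(* denq is the positive denominator in lowest terms. *)
Definition convergent_den (R : realType) (x : R) (k : nat) : nat :=
  `|denq (convergent x k)|%N.

Definition sum_partial_quotients (R : realType) (x : R) (K : nat) : int :=
  \sum_(1 <= k < K.+1) partial_quotient x k.

(* The convention for logarithms inside error terms. *)
Definition log_err (R : realType) (x : R) : R := ln (Num.max (expR 1) x).

(* Main.v *)
(* Write [y_n] for [||n alpha||], [d_k = |q_k alpha - p_k|] and [t = s_(K+1)].
   The integer [G_n = #{(m, z) : 1 <= m <= n / t, z - 1/m <= n alpha < z + 1/m}]
   differs from [min (1 / y_n) (n / t)] by at most 2. Each of its layers
   [m] is an indicator of [n alpha] near an integer, whose sum over a window of fewer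
   than [q_(K+1)] consecutive [n] has discrepancy O(t): split the window into
   [q_k]-blocks, on each of which [n alpha] is close to a permutation of the
   multiples of [1 / q_k].  As layer [m] starts at [n = m t], Abel summation makes
   its error O(1 / m), whence [sum G_n / n = (log N)^2 + O((1 + log t) (1 + log N))].

   It remains to sum [1 / (n y_n) - G_n / n] over [q_k <= n < q_(k+1)].  The
   multiples [n = j q_k] have [y_n = j d_k] up to wrap-around and give
   [a_(k+1) sum 1 / j^2], since [1 / (q_k d_k) = a_(k+1) + O(1)].  For the other [n]
   only those with [n y_n < 2 t] matter.  Let [z] be the residue of [n p_k] modulo
   [q_k] nearest to 0.  Either [q_k y_n >= |z| / 2], and summing [1 / |z|] over
   [|z| <= 4 t] costs [log t]; or [n = q_(k+1)] modulo [q_k], and then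
   [y_n >= (a_(k+1) - j) d_k] where [j = n / q_k], which costs [log a_(k+1)]. *)
Require Import Defs.
From mathcomp Require Import all_boot all_order all_algebra.
From mathcomp Require Import all_classical all_reals all_analysis.
From mathcomp Require Import zify ring lra.
Set Implicit Arguments.
Unset Strict Implicit.
Unset Printing Implicit Defensive.
Import Order.TTheory GRing.Theory Num.Theory.
Local Open Scope ring_scope.

(** * Harmonic and logarithmic sums *)

Definition harmonic (R : realType) (n : nat) : R := \sum_(1 <= i < n.+1) i%:R^-1.

Lemma harmonicS (R : realType) n : harmonic R n.+1 = harmonic R n + n.+1%:R^-1.
Proof. by rewrite /harmonic big_nat_recr. Qed.

Lemma harmonic0 (R : realType) : harmonic R 0 = 0.
Proof. by rewrite /harmonic big_geq. Qed.

Lemma harmonic_ge0 (R : realType) n : 0 <= harmonic R n.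
Proof. by apply: sumr_ge0 => i _; rewrite invr_ge0. Qed.

Lemma harmonic_mono (R : realType) m n : (m <= n)%N -> harmonic R m <= harmonic R n.
Proof.
elim: n => [|n IH]; first by rewrite leqn0 => /eqP ->.
rewrite leq_eqVlt => /orP[/eqP -> //|]; rewrite ltnS => /IH h.
by rewrite harmonicS (le_trans h) // lerDl invr_ge0.
Qed.

Lemma harmonic_ge1 (R : realType) n : (0 < n)%N -> 1 <= harmonic R n.
Proof.
move=> n0; apply: le_trans (harmonic_mono R n0).
by rewrite harmonicS harmonic0 add0r invr1.
Qed.

Lemma ln_succ_bounds (R : realType) n : (0 < n)%N ->
  n.+1%:R^-1 <= ln (n.+1%:R : R) - ln n%:R <= n%:R^-1.
Proof.
move=> n0.
have n0' : (0 : R) < n%:R by rewrite ltr0n.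
have S0' : (0 : R) < n.+1%:R by rewrite ltr0n.
rewrite -ln_div ?posrE //; apply/andP; split.
(* The lower bound is [ln (1 + x) <= x] at [x = - 1 / (n + 1)], read through the inverse. *)
- have -> : n.+1%:R / n%:R = (1 + (- n.+1%:R^-1))^-1 :> R.
    by rewrite -natr1; field; apply/andP; split; rewrite gt_eqF //; lra.
  have S2 : n.+1%:R^-1 < (1 : R) by rewrite invf_lt1 // ltr1n.
  rewrite lnV ?posrE ?subr_gt0 //.
  by rewrite lerNr; apply: le_ln1Dx; rewrite ltrN2.
- have -> : n.+1%:R / n%:R = 1 + n%:R^-1 :> R.
    by rewrite -natr1; field; rewrite gt_eqF.
  apply: le_ln1Dx; apply: lt_trans (_ : 0 < _); first by lra.
  by rewrite invr_gt0.
Qed.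

Lemma ln_le_harmonic (R : realType) n : ln (n.+1%:R : R) <= harmonic R n.
Proof.
elim: n => [|n IH]; first by rewrite harmonic0 ln1.
have /andP[_ h] := ln_succ_bounds R (ltn0Sn n); rewrite harmonicS.
by rewrite -lerBlDl (le_trans _ h) // lerD2l lerN2.
Qed.

Lemma harmonic_le_ln (R : realType) n : (0 < n)%N -> harmonic R n <= 1 + ln (n%:R : R).
Proof.
case: n => // n _; elim: n => [|n IH].
  by rewrite harmonicS harmonic0 ln1 invr1; lra.
have /andP[h _] := ln_succ_bounds R (ltn0Sn n); rewrite harmonicS.
by apply: le_trans (lerD IH h) _; rewrite -addrA (addrC (ln _)) subrK.
Qed.

Lemma harmonic_4_le (R : realType) n : (0 < n)%N ->
  harmonic R (4 * n) <= 4 + ln (n%:R : R).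
Proof.
move=> n0; have n40 : (0 < 4 * n)%N by rewrite muln_gt0.
apply: le_trans (harmonic_le_ln R n40) _; rewrite natrM lnM ?posrE ?ltr0n //.
have : ln (4 : R) <= 3; last by lra.
have -> : 4 = 1 + 3 :> R by lra.
by apply: le_ln1Dx; lra.
Qed.

Lemma ln_nat_ge0 (R : realType) n : 0 <= ln (n%:R : R).
Proof. by case: n => [|n]; [rewrite ln0 | rewrite ln_ge0 // ler1n]. Qed.

Lemma ln_nat_mono (R : realType) m n : (m <= n)%N -> ln (m%:R : R) <= ln n%:R.
Proof.
case: m => [|m] mn; first by rewrite ln0 // ln_nat_ge0.
by rewrite ler_ln ?posrE ?ltr0n ?ler_nat //; apply: leq_trans mn.
Qed.

(** Telescoping: each [1 / (n + 1)^2] is at most [1 / n - 1 / (n + 1)]. *)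
Lemma sum_inv_sq_tail (R : realType) m n : (0 < m)%N -> (m <= n)%N ->
  \sum_(m.+1 <= i < n.+1) (i%:R ^+ 2)^-1 <= m%:R^-1 - n%:R^-1 :> R.
Proof.
move=> m0; elim: n => [|n IH]; first by rewrite leqn0 => /eqP E; rewrite E in m0.
rewrite leq_eqVlt => /orP[/eqP -> //|]; first by rewrite big_geq // subrr.
rewrite ltnS => mn; rewrite big_nat_recr //=.
have n0 : (0 : R) < n%:R by rewrite ltr0n (leq_trans m0).
apply: le_trans (lerD (IH mn) (lexx _)) _.
suff : (n.+1%:R ^+ 2)^-1 <= n%:R^-1 - n.+1%:R^-1 :> R.
  by set u := n.+1%:R^-1; set w := (_ ^+ 2)^-1; lra.
rewrite -natr1.
have -> : n%:R^-1 - (n%:R + 1)^-1 = (n%:R * (n%:R + 1))^-1 :> R.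
  by field; rewrite !gt_eqF //; lra.
rewrite lef_pV2 ?posrE; nra.
Qed.

Lemma sum_inv_sq_le2 (R : realType) n : \sum_(1 <= i < n.+1) (i%:R ^+ 2)^-1 <= 2 :> R.
Proof.
case: n => [|n]; first by rewrite big_geq //.
rewrite big_ltn // expr1n invr1.
have := @sum_inv_sq_tail R 1 n.+1 isT isT; rewrite invr1.
have : 0 <= (n.+1)%:R^-1 :> R by rewrite invr_ge0.
by set u := _^-1; set w := \sum_(_ <= _ < _) _; lra.
Qed.

(** The increment [(ln n)^2 - (ln (n - 1))^2] of the target differs from the summand [2 ln n / n] by
    at most [8 / n]: the difference of consecutive logarithms exceeds [1 / n] by at most
    [1 / (n (n - 1))], and the factor [ln n <= n - 1] is harmless against that. *)
Lemma sum_ln_div (R : realType) N : (0 < N)%N ->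
  `| \sum_(1 <= n < N.+1) 2 * ln (n%:R : R) / n%:R - ln N%:R ^+ 2 | <= 8 * harmonic R N.
Proof.
case: N => // N _; elim: N => [|N IH].
  rewrite big_nat1 ln1 harmonicS harmonic0 expr0n /= mulr0 mul0r subrr normr0.
  by rewrite invr1; lra.
rewrite big_nat_recr //= harmonicS.
set S := \sum_(_ <= _ < _) _ in IH *.
have /andP[h1 h2] := ln_succ_bounds R (ltn0Sn N).
have l0 := ln_nat_ge0 R N.+1.
have lle : ln (N.+2%:R : R) <= N.+1%:R.
  by rewrite -[N.+2%:R]natr1 addrC le_ln1Dx // (lt_le_trans _ (ler0n _ _)) // ltrN10.
have n0 : (0 : R) < N.+1%:R by rewrite ltr0n.
set x := ln N.+1%:R in IH h1 h2 l0 *; set y := ln N.+2%:R in h1 h2 lle *.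
set u := (N.+2)%:R^-1 in h1 *.
have uE : N.+1%:R^-1 = u + u * N.+1%:R^-1 :> R.
  by rewrite /u -[N.+2%:R]natr1; field; rewrite !gt_eqF //; lra.
set v := N.+1%:R^-1 in h2 uE.
have u0 : 0 < u by rewrite /u invr_gt0 ltr0n.
have v0 : 0 < v by rewrite /v invr_gt0.
have v1 : v <= 1 by rewrite /v invf_le1 // ler1n.
have yv : y * v <= 1 by rewrite /v ler_pdivrMr // mul1r.
have v2 : v <= 2 * u by nra.
have key : `| 2 * y * u - (y ^+ 2 - x ^+ 2) | <= 8 * u.
  have -> : 2 * y * u - (y ^+ 2 - x ^+ 2) = (y - x) ^+ 2 - 2 * y * ((y - x) - u) by ring.
  have y0 : 0 <= y by lra.
  have A1 : 0 <= y * ((y - x) - u) by apply: mulr_ge0 => //; lra.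
  have A2 : y * ((y - x) - u) <= y * (u * v) by apply: ler_wpM2l => //; lra.
  have A3 : y * (u * v) <= u by rewrite mulrCA -[leRHS]mulr1 ler_wpM2l // ltW.
  have A4 : (y - x) ^+ 2 <= v by nra.
  have A5 : 0 <= (y - x) ^+ 2 by apply: sqr_ge0.
  by rewrite ler_norml; apply/andP; split; lra.
have -> : S + 2 * y * u - y ^+ 2 = (S - x ^+ 2) + (2 * y * u - (y ^+ 2 - x ^+ 2)) by ring.
by apply: le_trans (ler_normD _ _) _; lra.
Qed.

(** Abel summation against the decreasing weights [1 / i]. The induction bounds the weighted sum
    minus its boundary term by [D (1 / A - 1 / n)]; the boundary term itself costs the missing
    [D / n]. *)
Lemma abel_inequality (R : realType) (f : nat -> R) (D : R) (A B : nat) :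
  (0 < A)%N -> (A <= B)%N ->
  (forall n, (A <= n <= B)%N -> `| \sum_(A <= i < n) f i | <= D) ->
  `| \sum_(A <= i < B) f i / i%:R | <= D / A%:R.
Proof.
move=> A0 AB hD.
suff H : forall n, (A <= n <= B)%N ->
    `| \sum_(A <= i < n) f i / i%:R - (\sum_(A <= i < n) f i) / n%:R |
      <= D * (A%:R^-1 - n%:R^-1).
  have hB : (A <= B <= B)%N by rewrite AB leqnn.
  have h1 := H _ hB; have h2 := hD _ hB.
  set T := \sum_(_ <= _ < _) (_ / _) in h1 *.
  set S := \sum_(_ <= _ < _) f _ in h1 h2.
  have -> : T = (T - S / B%:R) + S / B%:R by ring.
  apply: le_trans (ler_normD _ _) _.
  have : `|S / B%:R| <= D / B%:R.
    by rewrite normrM [X in _ * X]ger0_norm ?invr_ge0 // ler_wpM2r ?invr_ge0.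
  lra.
elim=> [|n IH]; first by rewrite leqn0 => /andP[/eqP E]; rewrite E in A0.
case/andP; rewrite leq_eqVlt => /orP[/eqP <- _|].
  by rewrite !big_geq // mul0r subrr normr0 subrr mulr0.
rewrite ltnS => An nB; have {}IH := IH _; rewrite An (ltnW nB) in IH; have {}IH := IH isT.
have := hD n.+1; rewrite (leqW An) nB => /(_ isT).
rewrite !big_nat_recr //=.
set T := \sum_(_ <= _ < _) (_ / _) in IH *.
set S := \sum_(_ <= _ < _) f _ in IH *.
move=> hS.
have n0 : (0 : R) < n%:R by rewrite ltr0n (leq_trans A0).
have dpos : 0 <= n%:R^-1 - n.+1%:R^-1 :> R.
  by rewrite subr_ge0 lef_pV2 ?posrE ?ler_nat ?ltr0n // (leq_trans A0).
have -> : T + f n / n%:R - (S + f n) / n.+1%:R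
   = (T - S / n%:R) + (S + f n) * (n%:R^-1 - n.+1%:R^-1) by ring.
apply: le_trans (ler_normD _ _) _; rewrite normrM (ger0_norm dpos).
have := ler_wpM2r dpos hS.
by set w := n.+1%:R^-1; set u := n%:R^-1 in IH *; lra.
Qed.

(** * The tail of the Basel series *)

Section SineTangent.
Import numFieldNormedType.Exports.

Lemma sin_lt_id (R : realType) (x : R) : 0 < x -> x < pi / 2 -> sin x < x.
Proof.
move=> x0 xpi.
have [|c] := @MVT R sin cos 0 x x0 (fun z _ => is_derive_sin z).
  by apply: continuous_subspaceT => z; exact: continuous_sin.
rewrite in_itv /= sin0 !subr0 => /andP[c0 cx] ->.
rewrite -[ltRHS]mul1r ltr_pM2r //.
rewrite -(@cos0 R) ltr_cos // in_itv /=; have := @pi_ge2 R; lra.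
Qed.

Lemma id_lt_tan (R : realType) (x : R) : 0 < x -> x < pi / 2 -> x < tan x.
Proof.
move=> x0 xpi.
have cpos z : 0 <= z -> z <= x -> 0 < cos z.
  by move=> z0 zx; apply: cos_gt0_pihalf; lra.
have [||c] := @MVT R tan (fun z => (cos z) ^- 2) 0 x x0.
- move=> z; rewrite in_itv /= => /andP[z0 zx]; apply: is_derive_tan.
  by rewrite gt_eqF // cpos // ltW.
- apply: continuous_in_subspaceT => z; rewrite inE /= in_itv /= => /andP[z0 zx].
  by apply: continuous_tan; rewrite gt_eqF // cpos.
rewrite in_itv /= tan0 !subr0 => /andP[c0 cx] ->.
have cc := cpos c (ltW c0) (ltW cx).
have c1 : cos c < 1.
  by rewrite -(@cos0 R) ltr_cos // in_itv /=; have := @pi_ge2 R; lra.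
rewrite -[ltLHS]mul1r ltr_pM2r // invf_gt1 ?exprn_gt0 //.
nra.
Qed.

End SineTangent.

(** This is [sin x < x < tan x] together with [1 / tan^2 x = 1 / sin^2 x - 1]. *)
Lemma inv_sq_sandwich (R : realType) (x : R) : 0 < x -> x < pi / 2 ->
  (sin x ^+ 2)^-1 - 1 <= (x ^+ 2)^-1 <= (sin x ^+ 2)^-1.
Proof.
move=> x0 xpi.
have s1 := sin_lt_id x0 xpi; have t1 := id_lt_tan x0 xpi.
have s0 : 0 < sin x by apply: sin_gt0_pihalf; rewrite x0.
have c0 : 0 < cos x by apply: cos_gt0_pihalf; lra.
apply/andP; split; last by rewrite lef_pV2 ?posrE ?exprn_gt0 //; nra.
have -> : (sin x ^+ 2)^-1 - 1 = (tan x ^+ 2)^-1.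
  have h := cos2sin2 x.
  rewrite /tan expr_div_n invf_div h; field; rewrite gt_eqF //.
by rewrite lef_pV2 ?posrE ?exprn_gt0 //; nra.
Qed.

(* The duplication formula [csc^2 x + sec^2 x = 4 csc^2 2x] pairs the angles
   [k pi / 2^n] and [k pi / 2^n + pi / 2]. *)
Lemma sum_csc_sq (R : realType) n :
  \sum_(1 <= k < 2 ^ n) (sin (k%:R * pi / 2 ^+ n) ^+ 2)^-1 = (4 ^+ n - 1) / 3 :> R.
Proof.
elim: n => [|n IH]; first by rewrite big_geq // expr0 subrr mul0r.
have p2 : (0 < 2 ^ n)%N by rewrite expn_gt0.
have E : (2 ^ n.+1 = 2 ^ n + 2 ^ n)%N by rewrite expnS mul2n addnn.
have pw : 0 < 2 ^+ n :> R by rewrite exprn_gt0.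
rewrite (@big_cat_nat _ _ _ (2 ^ n)) //=; last by rewrite E leq_addr.
rewrite [X in _ + X]big_ltn; last by rewrite E -addn1 leq_add2l.
have -> : (2 ^ n)%:R * pi / 2 ^+ n.+1 = pi / 2 :> R.
  by rewrite natrX exprS; field; rewrite gt_eqF.
rewrite sin_pihalf expr1n invr1.
rewrite -[(2 ^ n).+1]add1n E big_addn addnK.
rewrite addrCA -big_split /=.
rewrite (_ : \sum_(_ <= _ < _) _ = 4 * ((4 ^+ n - 1) / 3)); first by rewrite exprS; field.
rewrite -IH mulr_sumr; apply: eq_big_nat => k /andP[k1 k2].
set x := k%:R * pi / 2 ^+ n.+1.
have -> : (k + 2 ^ n)%:R * pi / 2 ^+ n.+1 = x + pi / 2.
  by rewrite /x natrD natrX exprS; field; rewrite gt_eqF.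
have -> : k%:R * pi / 2 ^+ n = x *+ 2.
  by rewrite /x exprS; field; rewrite gt_eqF.
have x0 : 0 < x by rewrite /x divr_gt0 ?exprn_gt0 // mulr_gt0 ?pi_gt0 ?ltr0n.
have x1 : x < pi / 2.
  have -> : x = (k%:R / 2 ^+ n) * (pi / 2) by rewrite /x exprS; field; rewrite gt_eqF.
  have h : k%:R / 2 ^+ n < 1 :> R by rewrite ltr_pdivrMr // mul1r -natrX ltr_nat.
  by have := @pi_gt0 R; nra.
have s0 : 0 < sin x by apply: sin_gt0_pihalf; rewrite x0.
have c0 : 0 < cos x by apply: cos_gt0_pihalf; lra.
rewrite sinDpihalf sin_mulr2n -mulr_natr.
have h := cos2Dsin2 x.
have -> : (sin x ^+ 2)^-1 + (cos x ^+ 2)^-1 = (cos x ^+ 2 + sin x ^+ 2) / (cos x * sin x) ^+ 2.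
  by field; rewrite !gt_eqF.
by rewrite h; field; rewrite !gt_eqF.
Qed.

(** The reflection [k -> 2^(n+1) - k] preserves the sine, so the full sum at level [n + 1] is twice
    this one plus the middle term 1 at the angle [pi / 2]. *)
Lemma sum_csc_sq_half (R : realType) n :
  \sum_(1 <= k < 2 ^ n) (sin (k%:R * pi / 2 ^+ n.+1) ^+ 2)^-1 = (4 ^+ n.+1 - 4) / 6 :> R.
Proof.
have p2 : (0 < 2 ^ n)%N by rewrite expn_gt0.
have E : (2 ^ n.+1 = 2 ^ n + 2 ^ n)%N by rewrite expnS mul2n addnn.
have pw : 0 < 2 ^+ n :> R by rewrite exprn_gt0.
have := sum_csc_sq R n.+1.
rewrite (@big_cat_nat _ _ _ (2 ^ n)) //=; last by rewrite E leq_addr.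
rewrite [X in _ + X]big_ltn; last by rewrite E -addn1 leq_add2l.
have -> : (2 ^ n)%:R * pi / 2 ^+ n.+1 = pi / 2 :> R.
  by rewrite natrX exprS; field; rewrite gt_eqF.
rewrite sin_pihalf expr1n invr1.
rewrite -[(2 ^ n).+1]add1n E big_addn addnK [X in _ + (1 + X)]big_nat_rev /=.
rewrite (_ : \sum_(_ <= i < _) (sin ((1 + _ - _ + _)%:R * _ / _) ^+ 2)^-1 =
  \sum_(1 <= k < 2 ^ n) (sin (k%:R * pi / 2 ^+ n.+1) ^+ 2)^-1); first lra.
apply: eq_big_nat => k /andP[k1 k2].
have -> : (1 + 2 ^ n - k.+1 + 2 ^ n = 2 ^ n.+1 - k)%N by lia.
rewrite natrB; last by rewrite E ltnW // ltn_addr.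
have -> : ((2 ^ n.+1)%:R - k%:R) * pi / 2 ^+ n.+1 = - (k%:R * pi / 2 ^+ n.+1) + pi :> R.
  by rewrite natrX exprS; field; rewrite gt_eqF.
by rewrite sinDpi sinN opprK.
Qed.

(** Squeezing [1 / x^2] between [csc^2 x - 1] and [csc^2 x], whose finite sums are known exactly,
    evaluates the sum of [1 / j^2] over [j < 2^n] as [pi^2 / 6] up to [O(2^-n)]. Letting [n] grow
    leaves the tail beyond [J], which telescopes. *)
Lemma basel_tail (R : realType) J : (0 < J)%N ->
  0 <= (pi : R) ^+ 2 / 6 - \sum_(1 <= j < J.+1) (j%:R ^+ 2)^-1 <= (J%:R^-1 : R).
Proof.
move=> J0.
have pi0 := @pi_gt0 R.
pose Z M : R := \sum_(1 <= j < M) (j%:R ^+ 2)^-1.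
have main n : (pi : R) ^+ 2 / 6 - 4 * (pi : R) ^+ 2 / 2 ^+ n <= Z (2 ^ n)%N <= (pi : R) ^+ 2 / 6.
  have p2 : 0 < 2 ^+ n :> R by rewrite exprn_gt0.
  have H4 : 4 ^+ n.+1 = 4 * 2 ^+ n ^+ 2 :> R by rewrite exprS -exprM mulnC exprM expr2 -natrM.
  have T := sum_csc_sq_half R n; rewrite H4 in T.
  (* Rescaling [k] to the angle [k pi / 2^(n+1)], which lies below [pi / 2], brings the terms into
     the range of the sandwich. *)
  have ZE : Z (2 ^ n)%N = pi ^+ 2 / (4 * 2 ^+ n ^+ 2) *
      \sum_(1 <= k < 2 ^ n) ((k%:R * pi / 2 ^+ n.+1) ^+ 2)^-1.
    rewrite /Z mulr_sumr; apply: eq_big_nat => k /andP[k1 _].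
    have alg (x p w : R) : 0 < x -> 0 < p -> 0 < w ->
        (x ^+ 2)^-1 = p ^+ 2 / (4 * w ^+ 2) * ((x * p / (2 * w)) ^+ 2)^-1.
      by move=> h1 h2 h3; field; rewrite !gt_eqF.
    by rewrite [2 ^+ n.+1]exprS; apply: alg; rewrite ?ltr0n.
  have B k : (1 <= k < 2 ^ n)%N -> (sin (k%:R * (pi : R) / 2 ^+ n.+1) ^+ 2)^-1 - 1
      <= ((k%:R * (pi : R) / 2 ^+ n.+1) ^+ 2)^-1 <= ((sin (k%:R * (pi : R) / 2 ^+ n.+1) ^+ 2)^-1 : R).
    move=> /andP[k1 k2]; apply: inv_sq_sandwich.
      by rewrite divr_gt0 ?exprn_gt0 // mulr_gt0 ?ltr0n.
    have -> : k%:R * (pi : R) / 2 ^+ n.+1 = (k%:R / 2 ^+ n) * (pi / 2) :> R.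
      by rewrite exprS; field; rewrite gt_eqF.
    have h : k%:R / 2 ^+ n < 1 :> R by rewrite ltr_pdivrMr // mul1r -natrX ltr_nat.
    by nra.
  have U : \sum_(1 <= k < 2 ^ n) ((k%:R * (pi : R) / 2 ^+ n.+1) ^+ 2)^-1 <= (4 * 2 ^+ n ^+ 2 - 4) / 6 :> R.
    by rewrite -T; apply: ler_sum_nat => k /B /andP[].
  have L : (4 * 2 ^+ n ^+ 2 - 4) / 6 - 2 ^+ n <=
      \sum_(1 <= k < 2 ^ n) ((k%:R * (pi : R) / 2 ^+ n.+1) ^+ 2)^-1 :> R.
    rewrite -T.
    apply: le_trans (_ : \sum_(1 <= k < 2 ^ n) ((sin (k%:R * (pi : R) / 2 ^+ n.+1) ^+ 2)^-1 - 1) <= _).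
      rewrite big_split /= lerD2l sumr_const_nat mulNrn lerN2 natrB ?expn_gt0 //.
      by rewrite natrX; lra.
    by apply: ler_sum_nat => k /B /andP[].
  set V := \sum_(_ <= _ < _) _ in ZE U L; rewrite ZE.
  set w := 2 ^+ n in p2 U L *.
  have w1 : 1 <= w by rewrite /w exprn_ege1 // ler1n.
  have c0 : 0 < pi ^+ 2 / (4 * w ^+ 2) by rewrite divr_gt0 ?mulr_gt0 ?exprn_gt0.
  apply/andP; split.
    apply: le_trans (ler_wpM2l (ltW c0) L).
    have -> : pi ^+ 2 / (4 * w ^+ 2) * ((4 * w ^+ 2 - 4) / 6 - w) =
      pi ^+ 2 / 6 - pi ^+ 2 / w * (w^-1 / 6 + 4^-1) by field; rewrite gt_eqF.
    rewrite lerD2l lerN2 -(mulrA 4) (mulrC 4) ler_wpM2l ?divr_ge0 ?sqr_ge0 ?ltW //.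
    have v0 : 0 < w^-1 by rewrite invr_gt0.
    have v1 : w^-1 <= 1 by rewrite invf_le1.
    by nra.
  apply: le_trans (ler_wpM2l (ltW c0) U) _.
  have -> : pi ^+ 2 / (4 * w ^+ 2) * ((4 * w ^+ 2 - 4) / 6) =
      pi ^+ 2 / 6 - pi ^+ 2 / w ^+ 2 / 6 by field; rewrite gt_eqF.
  by rewrite gerBl divr_ge0 // divr_ge0 ?sqr_ge0.
have large (e : R) : 0 < e -> exists n, (J < 2 ^ n)%N /\ 4 * pi ^+ 2 / 2 ^+ n <= e.
  move=> e0; pose n := (J + (Num.truncn (4 * pi ^+ 2 / e)).+1)%N.
  have hn : (n < 2 ^ n)%N by apply: ltn_expl.
  exists n; split; first by apply: leq_ltn_trans hn; rewrite leq_addr.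
  rewrite ler_pdivrMr ?exprn_gt0 // -ler_pdivrMl // mulrC.
  have := @truncnS_gt R (4 * pi ^+ 2 / e) => /ltW h.
  apply: le_trans h _; rewrite -natrX ler_nat.
  by apply: leq_trans (ltnW hn); rewrite leq_addl.
apply/andP; split.
  have [n [Jn _]] := large 1 ltr01.
  have /andP[_ h] := main n; rewrite subr_ge0; apply: le_trans h.
  rewrite /Z (@big_cat_nat _ _ _ J.+1 1 (2 ^ n)%N) //= lerDl.
  by apply: sumr_ge0 => i _; rewrite invr_ge0 sqr_ge0.
rewrite lerBlDr; apply/ler_addgt0Pr => e e0.
have [n [Jn hn]] := large e e0.
have /andP[h _] := main n.
(* The terms from [J + 1] to [2^n - 1] add at most [1 / J], uniformly in [n]. *)
have := @sum_inv_sq_tail R J (2 ^ n).-1 J0; rewrite prednK ?expn_gt0 // => T.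
have {}T := T _; rewrite -ltnS prednK ?expn_gt0 // in T; have {}T := T Jn.
have Q : 0 <= ((2 ^ n).-1)%:R^-1 :> R by rewrite invr_ge0.
move: h; rewrite /Z (@big_cat_nat _ _ _ J.+1 1 (2 ^ n)%N) //=; lra.
Qed.

(** * Continued fractions *)

(* Indices are shifted by one with respect to the paper: [cf_num b n.+1] and
   [cf_den b n.+1] are [p_n] and [q_n], so that [cf_den b 0] is [q_(-1) = 0]. *)
Fixpoint cf_num (b : nat -> int) (n : nat) : int :=
  if n is m.+1 then
    if m is k.+1 then b m * cf_num b m + cf_num b k else b 0
  else 1.

Fixpoint cf_den (b : nat -> int) (n : nat) : int :=
  if n is m.+1 then
    if m is k.+1 then b m * cf_den b m + cf_den b k else 1
  else 0.

Lemma cf_numSS b n : cf_num b n.+2 = b n.+1 * cf_num b n.+1 + cf_num b n.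
Proof. by []. Qed.

Lemma cf_denSS b n : cf_den b n.+2 = b n.+1 * cf_den b n.+1 + cf_den b n.
Proof. by []. Qed.

(** [cfrac] unfolds from the first quotient, whereas the recurrences append the last one. Dropping
    the first quotient acts linearly on the pair of numerator and denominator, and this reconciles
    the two descriptions. *)
Lemma cf_shift b n :
  cf_num b n.+1 = b 0 * cf_num (b \o S) n + cf_den (b \o S) n
  /\ cf_den b n.+1 = cf_num (b \o S) n.
Proof.
(* Two consecutive indices are carried together because the recurrences have order two. *)
suff [] : (cf_num b n.+1 = b 0 * cf_num (b \o S) n + cf_den (b \o S) n
    /\ cf_den b n.+1 = cf_num (b \o S) n) /\
  (cf_num b n.+2 = b 0 * cf_num (b \o S) n.+1 + cf_den (b \o S) n.+1
    /\ cf_den b n.+2 = cf_num (b \o S) n.+1) by [].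
elim: n => [|n [[IH1 IH2] [IH3 IH4]]].
  by rewrite /= mulr1 !addr0 mulr1 mulrC.
split=> //; rewrite cf_numSS (cf_denSS b) IH3 IH4 IH1 IH2.
by rewrite (cf_numSS (b \o S)) (cf_denSS (b \o S)) /=; split=> //; ring.
Qed.

Lemma cf_den_gt0 b n : (forall i, 0 < b i.+1) -> 0 < cf_den b n.+1.
Proof.
move=> b0; suff [] : 0 <= cf_den b n /\ 0 < cf_den b n.+1 by [].
elim: n => // n [h1 h2]; split; first exact: ltW.
by rewrite cf_denSS ltr_wpDr // mulr_gt0.
Qed.

(** Numerators and denominators obey the same recurrence, so the determinant only changes sign at
    each step. *)
Lemma cf_det b n :
  cf_num b n.+1 * cf_den b n - cf_num b n * cf_den b n.+1 = - (-1) ^+ n.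
Proof.
elim: n => [|n IH]; first by rewrite /= mulr0 mul1r sub0r.
by rewrite cf_numSS cf_denSS exprS mulN1r -IH; ring.
Qed.

Lemma cfracE b k : (forall i, 0 < b i.+1) ->
  cfrac (b 0) [seq b i | i <- iota 1 k] =
  (cf_num b k.+1)%:~R / (cf_den b k.+1)%:~R.
Proof.
elim: k b => [|k IH] b b0; first by rewrite /= divr1.
have [E1 E2] := cf_shift b k.+1.
have c0 : (cf_num (b \o S) k.+1)%:~R != 0 :> rat.
  by rewrite intr_eq0 -E2 gt_eqF // cf_den_gt0.
rewrite -[LHS]/((b 0)%:~R + (cfrac (b 1) [seq b i | i <- iota (1 + 1) k])^-1).
rewrite iotaDl -map_comp E1 E2.
rewrite (IH (b \o S) (fun i => b0 i.+1) :
  cfrac (b 1) [seq (b \o addn 1) i | i <- iota 1 k] = _).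
by rewrite invf_div intrD intrM mulrDl mulfK.
Qed.

(** The determinant identity supplies Bezout coefficients, so the fraction given by the recurrences
    is already in lowest terms. *)
Lemma cf_den_denq b k : (forall i, 0 < b i.+1) ->
  `|denq (cfrac (b 0) [seq b i | i <- iota 1 k])|%N = `|cf_den b k.+1|%N.
Proof.
move=> b0; rewrite cfracE // coprimeq_den.
  by rewrite gt_eqF ?cf_den_gt0 // absz_id.
have := cf_det b k.
set p := cf_num b k.+1; set q := cf_den b k.+1 => E.
have : coprimez p q.
  apply/coprimezP; exists (- (-1) ^+ k * cf_den b k, (-1) ^+ k * cf_num b k) => /=.
  transitivity (- (-1) ^+ k * (p * cf_den b k - cf_num b k * q)); first by ring.
  by rewrite E mulNr mulrN opprK -expr2 sqrr_sign.
by rewrite coprimezE.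
Qed.

(** * Convergents of an irrational number and their distances *)

Definition cquot (R : realType) (alpha : R) (n : nat) : nat :=
  `|partial_quotient alpha n|%N.

Definition cden (R : realType) (alpha : R) (n : nat) : nat :=
  `|cf_den (partial_quotient alpha) n|%N.

Definition cnum (R : realType) (alpha : R) (n : nat) : int :=
  cf_num (partial_quotient alpha) n.

(* [cdist alpha n.+1] is [|q_n alpha - p_n|]. *)
Definition cdist (R : realType) (alpha : R) (n : nat) : R :=
  \prod_(1 <= i < n.+1) (complete_quotient alpha i)^-1.

Lemma irrational_neq (R : realType) (x : R) (r : rat) : irrational x -> x != ratr r.
Proof. by move=> ix; apply/eqP => E; apply: ix; exists r. Qed.

Lemma complete_quotientS (R : realType) (alpha : R) k :
  complete_quotient alpha k.+1 =
  (complete_quotient alpha k - (partial_quotient alpha k)%:~R)^-1.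
Proof. by []. Qed.

Lemma complete_quotient_irrational (R : realType) (alpha : R) k :
  irrational alpha -> irrational (complete_quotient alpha k).
Proof.
move=> ia; elim: k => // k IH [r _ E]; apply: IH.
exists ((partial_quotient alpha k)%:~R + r^-1) => //.
rewrite rmorphD /= fmorphV /= E ratr_int complete_quotientS invrK addrC subrK //.
Qed.

Lemma complete_quotient_itv (R : realType) (alpha : R) k : irrational alpha ->
  0 < complete_quotient alpha k - (partial_quotient alpha k)%:~R < 1.
Proof.
move=> ia; have := floor_itv (complete_quotient alpha k).
rewrite -/(partial_quotient alpha k) intrD => /andP[h1 h2].
rewrite subr_gt0 lt_neqAle h1 andbT ltrBlDl h2 andbT.
rewrite eq_sym -(ratr_int R); apply: irrational_neq.
exact: complete_quotient_irrational.
Qed.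

Lemma complete_quotient_gt1 (R : realType) (alpha : R) k : irrational alpha ->
  1 < complete_quotient alpha k.+1.
Proof.
move=> /(complete_quotient_itv k) /andP[h1 h2].
by rewrite complete_quotientS invf_gt1.
Qed.

Lemma partial_quotient_gt0 (R : realType) (alpha : R) k : irrational alpha ->
  0 < partial_quotient alpha k.+1.
Proof. by move=> ia; rewrite floor_gt0 ltW // complete_quotient_gt1. Qed.

Lemma cquot_gt0 (R : realType) (alpha : R) k : irrational alpha ->
  (0 < cquot alpha k.+1)%N.
Proof. by move=> /(partial_quotient_gt0 k); rewrite /cquot absz_gt0 => /gt_eqF ->. Qed.

Lemma cquotE (R : realType) (alpha : R) k : irrational alpha ->
  partial_quotient alpha k.+1 = cquot alpha k.+1.
Proof. by move=> /(partial_quotient_gt0 k) h; rewrite /cquot gtz0_abs. Qed.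

Lemma convergent_denE (R : realType) (alpha : R) k : irrational alpha ->
  convergent_den alpha k = cden alpha k.+1.
Proof. by move=> ia; apply: cf_den_denq => i; apply: partial_quotient_gt0. Qed.

Lemma cdenE (R : realType) (alpha : R) n : irrational alpha ->
  cden alpha n = cf_den (partial_quotient alpha) n :> int.
Proof.
case: n => // n ia; rewrite /cden gez0_abs // ltW // cf_den_gt0 // => i.
exact: partial_quotient_gt0.
Qed.

Lemma cdenSS (R : realType) (alpha : R) n : irrational alpha ->
  cden alpha n.+2 = (cquot alpha n.+1 * cden alpha n.+1 + cden alpha n)%N.
Proof.
move=> ia; apply/eqP; rewrite -eqz_nat PoszD PoszM !cdenE // -cquotE //.
Qed.

Lemma cden_gt0 (R : realType) (alpha : R) n : irrational alpha ->
  (0 < cden alpha n.+1)%N.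
Proof.
by move=> ia; rewrite -ltz_nat cdenE // cf_den_gt0 // => i; apply: partial_quotient_gt0.
Qed.

Lemma cden_leS (R : realType) (alpha : R) n : irrational alpha ->
  (cden alpha n <= cden alpha n.+1)%N.
Proof.
move=> ia; case: n => // n; rewrite cdenSS // (leq_trans _ (leq_addr _ _)) //.
by rewrite leq_pmull // cquot_gt0.
Qed.

Lemma cden_fib (R : realType) (alpha : R) n : irrational alpha ->
  (2 * cden alpha n <= cden alpha n.+2)%N.
Proof.
move=> ia; rewrite cdenSS // mul2n -addnn leq_add2r.
apply: leq_trans (cden_leS _ ia) _; by rewrite leq_pmull // cquot_gt0.
Qed.

Lemma prod_cquot_le (R : realType) (alpha : R) n : irrational alpha ->
  (\prod_(1 <= i < n.+1) cquot alpha i <= cden alpha n.+1)%N.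
Proof.
move=> ia; elim: n => [|n IH]; first by rewrite big_geq.
rewrite big_nat_recr //= cdenSS // mulnC.
by apply: leq_trans (leq_addr _ _); rewrite leq_pmul2l // cquot_gt0.
Qed.

Lemma cdist0 (R : realType) (alpha : R) : cdist alpha 0 = 1.
Proof. by rewrite /cdist big_geq. Qed.

Lemma cdistS (R : realType) (alpha : R) n :
  cdist alpha n.+1 = cdist alpha n / complete_quotient alpha n.+1.
Proof. by rewrite /cdist big_nat_recr. Qed.

Lemma cdist_gt0 (R : realType) (alpha : R) n : irrational alpha -> 0 < cdist alpha n.
Proof.
move=> ia; elim: n => [|n IH]; first by rewrite cdist0.
by rewrite cdistS divr_gt0 // (lt_trans ltr01) // complete_quotient_gt1.
Qed.

(** The defining relation of the complete quotients, multiplied by the product of inverses up to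
    that index. In classical indices it reads [d_(n-1) = a_(n+1) d_n + d_(n+1)]. *)
Lemma cdist_rec (R : realType) (alpha : R) n : irrational alpha ->
  cdist alpha n = (cquot alpha n.+1)%:R * cdist alpha n.+1 + cdist alpha n.+2.
Proof.
move=> ia; rewrite (cdistS _ n.+1) (complete_quotientS _ n.+1) invrK cquotE //.
rewrite pmulrn mulrBr mulrC addrC subrK cdistS divfK // gt_eqF //.
by rewrite (lt_trans ltr01) // complete_quotient_gt1.
Qed.

(** In classical indices, [q_n d_(n-1) + q_(n-1) d_n = 1]: the denominators ascend and the distances
    descend with the same quotients, so the expression keeps its initial value. All size estimates
    for [cdist] come from it. *)
Lemma cden_cdist (R : realType) (alpha : R) n : irrational alpha ->
  (cden alpha n.+1)%:R * cdist alpha n + (cden alpha n)%:R * cdist alpha n.+1 = 1.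
Proof.
move=> ia; elim: n => [|n IH]; first by rewrite cdist0 /cden /= mul0r addr0 mulr1.
by rewrite cdenSS // -[RHS]IH (cdist_rec n) // natrD natrM; ring.
Qed.

(** Both sides obey one recurrence, the alternating sign absorbing the opposite direction of
    [cdist_rec]. This shows that the product [cdist] is the distance of [q alpha] from [p], and on
    which side [q alpha] lies. *)
Lemma cden_mul (R : realType) (alpha : R) n : irrational alpha ->
  (cden alpha n)%:R * alpha = (cnum alpha n)%:~R - (-1) ^+ n * cdist alpha n.
Proof.
move=> ia.
suff [] : (cden alpha n)%:R * alpha = (cnum alpha n)%:~R - (-1) ^+ n * cdist alpha n
 /\ (cden alpha n.+1)%:R * alpha = (cnum alpha n.+1)%:~R - (-1) ^+ n.+1 * cdist alpha n.+1 by [].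
elim: n => [|n [IH1 IH2]].
  rewrite cdist0 /cden /= mul0r expr0 mulr1 subrr; split=> //.
  rewrite cdistS cdist0 expr1 mul1r mulN1r opprK complete_quotientS invrK.
  by rewrite mul1r addrC subrK.
split=> //; rewrite cdenSS // natrD natrM mulrDl -mulrA IH2 IH1 /cnum cf_numSS.
rewrite intrD intrM cquotE // (cdist_rec n) // -pmulrn !exprS.
ring.
Qed.

Lemma cnum_det (R : realType) (alpha : R) n : irrational alpha ->
  cnum alpha n.+1 * cden alpha n - cnum alpha n * cden alpha n.+1 = - (-1) ^+ n :> int.
Proof. by move=> ia; rewrite !cdenE // cf_det. Qed.

Lemma cdist_leV (R : realType) (alpha : R) n : irrational alpha ->
  cdist alpha n <= (cden alpha n.+1)%:R^-1.
Proof.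
move=> ia; have q0 : (0 : R) < (cden alpha n.+1)%:R by rewrite ltr0n cden_gt0.
rewrite -[leRHS]mul1r ler_pdivlMr // mulrC -[leRHS](cden_cdist n ia) lerDl.
by rewrite mulr_ge0 // ltW // cdist_gt0.
Qed.

Lemma cdist_leS (R : realType) (alpha : R) n : irrational alpha ->
  cdist alpha n.+1 <= cdist alpha n.
Proof.
move=> ia; rewrite (cdist_rec n) //.
have h1 := cdist_gt0 n.+1 ia; have h2 := cdist_gt0 n.+2 ia.
have h3 : (1 : R) <= (cquot alpha n.+1)%:R by rewrite ler1n cquot_gt0.
by nra.
Qed.

Lemma cdist_geV (R : realType) (alpha : R) n : irrational alpha ->
  (2 * (cden alpha n.+1)%:R)^-1 <= cdist alpha n.
Proof.
move=> ia; have q0 : (0 : R) < (cden alpha n.+1)%:R by rewrite ltr0n cden_gt0.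
rewrite -[leLHS]mul1r ler_pdivrMr ?mulr_gt0 // -[leLHS](cden_cdist n ia).
have h1 := cdist_gt0 n ia; have h2 := cdist_leS n ia.
have h3 : (cden alpha n)%:R <= (cden alpha n.+1)%:R :> R by rewrite ler_nat cden_leS.
have h4 : 0 <= (cden alpha n)%:R :> R by [].
have := cdist_gt0 n.+1 ia.
by nra.
Qed.

(** * Discrepancy over windows *)

(** As [p] is invertible modulo [q], the map [r -> c + r p] is injective on residues, hence a
    permutation. *)
Lemma modz_permutation (R : realType) (p c : int) (q : nat) (F : nat -> R) :
  (0 < q)%N -> coprimez p q ->
  \sum_(0 <= r < q) F `|((c + r%:Z * p) %% q)%Z|%N = \sum_(0 <= h < q) F h.
Proof.
move=> q0 cpq; rewrite !big_mkord.
have lt_mod (z : int) : (`|(z %% q)%Z| < q)%N.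
  by rewrite -ltz_nat gez0_abs ?modz_ge0 ?ltz_pmod // -lt0n.
pose f (r : 'I_q) : 'I_q := Ordinal (lt_mod (c + r%:Z * p)).
have f_inj : injective f.
  move=> r r' /(congr1 val) /= /(congr1 Posz).
  rewrite !gez0_abs ?modz_ge0 -?lt0n // => /eqP.
  rewrite eqz_mod_dvd opprD addrACA subrr add0r -mulrBl Gauss_dvdzl; last first.
    by rewrite coprimez_sym.
  move=> /dvdzP[z Ez]; apply/val_inj => /=.
  have {}Ez : r%:Z - r'%:Z = z * q%:Z by exact: Ez.
  have rq := ltn_ord r; have rq' := ltn_ord r'.
  by case: (ltgtP z 0) => hz; [nia|nia|lia].
by rewrite [RHS](reindex_inj f_inj).
Qed.

Lemma sum_natr (R : realType) q : \sum_(0 <= h < q) (h%:R : R) = q%:R * (q%:R - 1) / 2.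
Proof.
elim: q => [|q IH]; first by rewrite big_geq // !mul0r.
by rewrite big_nat_recr //= IH -natr1; field.
Qed.

Lemma sum_constr (R : realType) q (c : R) : \sum_(0 <= r < q) c = q%:R * c.
Proof. by rewrite sumr_const_nat subn0 mulr_natl. Qed.

(** With [m] the floor of [q g], the floor of [(r p + q g) / q] is the integer quotient of [m + r p]
    by [q]. The remainders run once through [0, ..., q - 1], so their sum is explicit. *)
Lemma sum_floor (R : realType) (p : int) (q : nat) (g : R) :
  (0 < q)%N -> coprimez p q ->
  \sum_(0 <= r < q) (Num.floor (r%:R * p%:~R / q%:R + g))%:~R =
  \sum_(0 <= r < q) (r%:R * p%:~R / q%:R : R)
  + (Num.floor (q%:R * g))%:~R - (q%:R - 1) / 2 :> R.
Proof.
move=> q0 cpq; set m := Num.floor (q%:R * g).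
have q0' : (0 : R) < q%:R by rewrite ltr0n.
have floorE (r : nat) : (Num.floor (r%:R * p%:~R / q%:R + g))%:~R =
    r%:R * p%:~R / q%:R + m%:~R / q%:R
      - `|((m + r%:Z * p) %% q)%Z|%N%:R / q%:R :> R.
  set z := m + r%:Z * p.
  have zE : z%:~R = (z %/ q)%Z%:~R * q%:R + `|(z %% q)%Z|%N%:R :> R.
    rewrite {1}(divz_eq z q) intrD intrM; congr (_ + _).
    by rewrite -[in LHS](gez0_abs (modz_ge0 z _)) // -lt0n.
  have zE' : z%:~R = m%:~R + r%:R * p%:~R :> R by rewrite /z intrD intrM.
  have hq : (`|(z %% q)%Z|%N < q)%N.
    by rewrite -ltz_nat gez0_abs ?modz_ge0 ?ltz_pmod // -lt0n.
  have -> : Num.floor (r%:R * p%:~R / q%:R + g) = (z %/ q)%Z.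
    apply: floor_def; rewrite intrD mulr1z.
    have -> : r%:R * p%:~R / q%:R + g =
        (z %/ q)%Z%:~R + (`|(z %% q)%Z|%N%:R + (q%:R * g - m%:~R)) / q%:R.
      have -> : r%:R * p%:~R = (z %/ q)%Z%:~R * q%:R + `|(z %% q)%Z|%N%:R - m%:~R :> R.
        by rewrite -zE zE'; ring.
      by field; rewrite gt_eqF.
    have /andP[m1 m2] := floor_itv (q%:R * g); rewrite -/m intrD mulr1z in m1 m2.
    have h0 : 0 <= `|(z %% q)%Z|%N%:R :> R by [].
    have h1 : `|(z %% q)%Z|%N%:R + 1 <= q%:R :> R by rewrite natr1 ler_nat.
    set h := `|(z %% q)%Z|%N%:R in h0 h1 *.
    have k1 : 0 <= h + (q%:R * g - m%:~R) by clear -h0 m1; lra.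
    have k2 : h + (q%:R * g - m%:~R) < q%:R by clear -h1 m2; lra.
    by rewrite lerDl ltrD2l ltr_pdivrMr // mul1r k2 divr_ge0 // ltW.
  have -> : (z %/ q)%Z%:~R = (z%:~R - `|(z %% q)%Z|%N%:R) / q%:R :> R.
    by rewrite zE addrK mulfK // gt_eqF.
  by rewrite zE'; ring.
have P := modz_permutation m (fun h => h%:R / q%:R : R) q0 cpq.
rewrite /= -[in RHS]mulr_suml sum_natr in P.
rewrite (eq_bigr _ (fun r _ => floorE r)) !big_split /= sumrN sum_constr P.
by set A := \sum_(_ <= _ < _) _; field; rewrite gt_eqF.
Qed.

(** The sawtooth: the fractional part centred at its mean, so that its sums measure discrepancy. *)
Definition saw (R : realType) (x : R) : R := x - (Num.floor x)%:~R - 2^-1.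

Lemma cnum_coprime (R : realType) (alpha : R) n : irrational alpha ->
  coprimez (cnum alpha n.+1) (cden alpha n.+1).
Proof.
move=> ia; have E := cnum_det n ia.
apply/coprimezP.
exists (- (-1) ^+ n * (cden alpha n)%:Z, (-1) ^+ n * cnum alpha n) => /=.
set p := cnum alpha n.+1 in E *.
transitivity (- (-1) ^+ n * (p * cden alpha n - cnum alpha n * cden alpha n.+1) : int).
  by ring.
by rewrite E mulNr mulrN opprK -expr2 sqrr_sign.
Qed.

Lemma sum_saw (R : realType) q (f : nat -> R) :
  \sum_(0 <= r < q) saw (f r) =
  \sum_(0 <= r < q) f r - \sum_(0 <= r < q) (Num.floor (f r))%:~R - q%:R / 2.
Proof. by rewrite /saw !sumrB sum_constr. Qed.

(** For [r < q] the point [r alpha] lies within [1 / q] of [r p / q], and for the latter the floors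
    sum exactly. *)
Lemma saw_block (R : realType) (alpha g : R) n : irrational alpha ->
  `| \sum_(0 <= r < cden alpha n.+1) saw (r%:R * alpha + g) | <= 3.
Proof.
move=> ia; set q := cden alpha n.+1; set p := cnum alpha n.+1.
have q0 : (0 < q)%N by rewrite cden_gt0.
have q0' : (0 : R) < q%:R by rewrite ltr0n.
have cpq : coprimez p q := cnum_coprime n ia.
pose e := - (-1) ^+ n.+1 * cdist alpha n.+1.
have eE : q%:R * alpha = p%:~R + e by rewrite cden_mul // /e mulNr.
have e1 : `|e| <= q%:R^-1.
  rewrite /e normrM normrN normrX normrN1 expr1n mul1r gtr0_norm ?cdist_gt0 //.
  apply: le_trans (cdist_leV _ ia) _.
  by rewrite lef_pV2 ?posrE ?ltr0n ?cden_gt0 // ler_nat cden_leS.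
have alphaE (r : nat) : r%:R * alpha = r%:R * p%:~R / q%:R + r%:R / q%:R * e.
  have -> : alpha = (p%:~R + e) / q%:R by rewrite -eE mulrC mulKf // gt_eqF.
  by ring.
have re1 (r : nat) : (0 <= r < q)%N -> `| r%:R / q%:R * e | <= q%:R^-1.
  move=> /andP[_ rq]; rewrite normrM; apply: le_trans e1.
  rewrite ger0_norm ?divr_ge0 // ler_piMl // ler_pdivrMr // mul1r ler_nat ltnW //.
set F := \sum_(0 <= r < q) (Num.floor (r%:R * alpha + g))%:~R : R.
set A := \sum_(0 <= r < q) (r%:R * p%:~R / q%:R : R).
have S : \sum_(0 <= r < q) saw (r%:R * alpha + g) =
    A + q%:R * g + \sum_(0 <= r < q) r%:R / q%:R * e - F - q%:R / 2.
  rewrite sum_saw (eq_bigr (fun r : nat => r%:R * p%:~R / q%:R + r%:R / q%:R * e + g)); last first.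
    by move=> r _; rewrite alphaE.
  by rewrite !big_split /= sum_constr -/A -/F; ring.
have E : `| \sum_(0 <= r < q) r%:R / q%:R * e | <= 1.
  apply: le_trans (ler_norm_sum _ _ _) _.
  apply: le_trans (_ : \sum_(0 <= r < q) q%:R^-1 <= _); first exact: ler_sum_nat.
  by rewrite sum_constr mulfV ?gt_eqF.
(* The deviation [1 / q] is moved into [g]; this changes [q g] by 1, hence the exact sum by a
   bounded amount. *)
have FU : F <= A + (q%:R * g + 1) - (q%:R - 1) / 2.
  apply: le_trans (_ : A + (Num.floor (q%:R * (g + q%:R^-1)))%:~R - (q%:R - 1) / 2 <= _).
    rewrite -sum_floor //; apply: ler_sum_nat => r /re1.
    rewrite ler_norml => /andP[_ h]; rewrite ler_int le_floor // alphaE; lra.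
  rewrite lerD2r lerD2l; apply: le_trans (floor_le _) _.
  by rewrite mulrDr mulfV ?gt_eqF.
have FL : A + (q%:R * g - 2) - (q%:R - 1) / 2 <= F.
  apply: le_trans (_ : A + (Num.floor (q%:R * (g - q%:R^-1)))%:~R - (q%:R - 1) / 2 <= _).
    rewrite lerD2r lerD2l mulrBr mulfV ?gt_eqF //.
    have /andP[_] := floor_itv (q%:R * g - 1); rewrite intrD; lra.
  rewrite -sum_floor //; apply: ler_sum_nat => r /re1.
  rewrite ler_norml => /andP[h _]; rewrite ler_int le_floor // alphaE; lra.
rewrite S; move: E; rewrite !ler_norml.
set X := \sum_(_ <= _ < _) _; set G := q%:R * g in FU FL *; lra.
Qed.

Definition cquot_sum (R : realType) (alpha : R) n : nat :=
  (\sum_(1 <= i < n.+1) cquot alpha i)%N.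

(** The window is cut into full blocks of length [q], each costing 3, and a remainder shorter than
    [q], left to the induction. Each level contributes at most as many blocks as its partial
    quotient. *)
Lemma saw_window (R : realType) (alpha g : R) n L : irrational alpha ->
  (L < cden alpha n.+1)%N ->
  `| \sum_(0 <= r < L) saw (r%:R * alpha + g) | <= 3 * (cquot_sum alpha n)%:R.
Proof.
move=> ia; elim: n g L => [|n IH] g L.
  by rewrite ltnS leqn0 => /eqP ->; rewrite big_geq // normr0 mulr_ge0.
set q := cden alpha n.+1 => Lq.
have q0 : (0 < q)%N by rewrite cden_gt0.
(* The offset is universally quantified because passing to the next block replaces [g] by
   [g + q alpha]. *)
have blocks b : forall g, `| \sum_(0 <= r < b * q + L %% q) saw (r%:R * alpha + g) |
    <= 3 * b%:R + 3 * (cquot_sum alpha n)%:R.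
  elim: b => [|b IHb] g'; first by rewrite mul0n add0n mulr0 add0r IH // ltn_mod.
  rewrite mulSn -addnA (@big_cat_nat _ _ _ q) ?leq_addr //=.
  rewrite -{2}[q]add0n big_addn addKn.
  apply: le_trans (ler_normD _ _) _.
  have h1 := saw_block g' n ia.
  rewrite [X in _ + `|X|](eq_bigr (fun r : nat => saw (r%:R * alpha + (g' + q%:R * alpha)))); last first.
    by move=> r _; congr saw; rewrite natrD; ring.
  have h2 := IHb (g' + q%:R * alpha).
  have -> : 3 * b.+1%:R = 3 + 3 * b%:R :> R by rewrite -natr1; ring.
  by rewrite -addrA lerD.
rewrite (divn_eq L q); apply: le_trans (blocks _ g) _.
rewrite -mulrDr ler_pM2l // -natrD ler_nat /cquot_sum [leqRHS]big_nat_recr //=.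
rewrite addnC leq_add2l -ltnS ltn_divLR // mulSn.
apply: leq_trans Lq _; rewrite cdenSS // addnC leq_add2r cden_leS //.
Qed.

(* The number of integers in the half-open interval (x - 1/m, x + 1/m] *)
Definition near_int (R : realType) (m : nat) (x : R) : R :=
  (Num.floor (x + m%:R^-1))%:~R - (Num.floor (x - m%:R^-1))%:~R.

(** With [u = 1 / m], the summand is [saw (x - u) - saw (x + u)], so two window bounds suffice. *)
Lemma near_int_window (R : realType) (alpha : R) m n A B : irrational alpha ->
  (B - A < cden alpha n.+1)%N ->
  `| \sum_(A <= i < B) (near_int m (i%:R * alpha) - 2 * m%:R^-1) |
    <= 6 * (cquot_sum alpha n)%:R.
Proof.
move=> ia AB; rewrite -{1}[A]add0n big_addn.
set u := m%:R^-1.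
have h1 := saw_window (A%:R * alpha - u) ia AB.
have h2 := saw_window (A%:R * alpha + u) ia AB.
have -> : \sum_(0 <= i < B - A) (near_int m ((i + A)%:R * alpha) - 2 * u) =
   \sum_(0 <= i < B - A) saw (i%:R * alpha + (A%:R * alpha - u)) -
   \sum_(0 <= i < B - A) saw (i%:R * alpha + (A%:R * alpha + u)).
  rewrite -sumrB; apply: eq_bigr => i _.
  rewrite /near_int /saw -/u natrD mulrDl !addrA; ring.
apply: le_trans (ler_normB _ _) _; lra.
Qed.

(** * Counting near-integers *)

(** The infimum is attained at the floor of [x] or at its successor, which replaces it by a concrete
    nearest integer. *)
Lemma nearest_int_distP (R : realType) (x : R) : exists m : int,
  [/\ nearest_int_dist x = `|x - m%:~R|, `|x - m%:~R| <= 2^-1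
    & forall m' : int, nearest_int_dist x <= `|x - m'%:~R|].
Proof.
have /andP[f1 f2] := floor_itv x; rewrite intrD mulr1z in f2.
set f := Num.floor x in f1 f2.
have gap (m : int) : m%:~R <= f%:~R :> R \/ f%:~R + 1 <= m%:~R :> R.
  have [h|h] := leP m f; [left | right]; first by rewrite ler_int.
  by rewrite -[1]/(1%:~R) -intrD ler_int lezD1.
have [m0 hm0 lem0] : exists2 m0 : int, `|x - m0%:~R| <= 2^-1 &
    forall m : int, `|x - m0%:~R| <= `|x - m%:~R|.
  have [h|h] := leP (x - f%:~R) 2^-1.
    have E : `|x - f%:~R| = x - f%:~R by rewrite ger0_norm // subr_ge0.
    exists f; rewrite E // => m; rewrite ler_normr.
    by case: (gap m) => hm; apply/orP; [left | right]; lra.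
  have E : `|x - (f + 1)%:~R| = f%:~R + 1 - x.
    by rewrite intrD mulr1z ler0_norm ?opprB // subr_le0 ltW.
  exists (f + 1); rewrite E; first lra.
  move=> m; rewrite ler_normr.
  by case: (gap m) => hm; apply/orP; [left | right]; lra.
have lb : lbound [set `|x - m%:~R| | m in [set: int]]%classic `|x - m0%:~R|.
  by move=> _ [m _ <-].
have E : nearest_int_dist x = `|x - m0%:~R|.
  apply/eqP; rewrite eq_le; apply/andP; split.
    by apply: ge_inf; [exists `|x - m0%:~R| | exists m0].
  by apply: lb_le_inf => //; exists `|x - m0%:~R|; exists m0.
by exists m0; rewrite E.
Qed.

Lemma nearest_int_dist_le (R : realType) (x : R) (m : int) :
  nearest_int_dist x <= `|x - m%:~R|.
Proof. by have [m0 [_ _ ->]] := nearest_int_distP x. Qed.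

Lemma nearest_int_dist_le_half (R : realType) (x : R) : nearest_int_dist x <= 2^-1.
Proof. by have [m0 [-> h _]] := nearest_int_distP x. Qed.

Lemma near_int_ge0 (R : realType) m (x : R) : 0 <= near_int m x.
Proof.
rewrite subr_ge0 ler_int le_floor //.
have : 0 <= (m%:R)^-1 :> R by rewrite invr_ge0.
by set u := _^-1; lra.
Qed.

Lemma near_int_ge1 (R : realType) m (x : R) :
  nearest_int_dist x < m%:R^-1 -> 1 <= near_int m x.
Proof.
have [z [-> _ _]] := nearest_int_distP x; rewrite /near_int; set u := m%:R^-1.
rewrite ltr_norml => /andP[h1 h2].
have k1 : z <= Num.floor (x + u) by rewrite floor_ge_int; lra.
have k2 : Num.floor (x - u) < z by rewrite floor_lt_int; lra.
rewrite -intrB (ler_int R 1).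
by move: (Num.floor (x + u)) (Num.floor (x - u)) k1 k2 => a b; lia.
Qed.

Lemma near_int_le2 (R : realType) (x : R) : near_int 1 x <= 2.
Proof.
rewrite /near_int invr1 -intrB (ler_int R _ 2).
have h1 : Num.floor (x + 1) < Num.floor (x - 1) + 3.
  rewrite floor_lt_int intrD.
  by have /andP[_] := floor_itv (x - 1); rewrite intrD mulr1z; lra.
by move: (Num.floor (x + 1)) (Num.floor (x - 1)) h1 => a b; lia.
Qed.

Lemma near_int_le1 (R : realType) m (x : R) : near_int m.+2 x <= 1.
Proof.
rewrite /near_int; set u := _^-1.
have u2 : u <= 2^-1 by rewrite /u lef_pV2 ?posrE ?ltr0n // ler_nat.
rewrite -intrB (ler_int R _ 1).
have h1 : Num.floor (x + u) < Num.floor (x - u) + 2; last by lia.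
rewrite floor_lt_int intrD.
by have /andP[_] := floor_itv (x - u); rewrite intrD mulr1z; lra.
Qed.

Lemma near_int_le0 (R : realType) m (x : R) :
  m%:R^-1 < nearest_int_dist x -> near_int m x <= 0.
Proof.
rewrite /near_int; set u := m%:R^-1 => h.
rewrite -intrB (ler_int R _ 0) subr_le0 leNgt; apply/negP => lt.
have := nearest_int_dist_le x (Num.floor (x + u)).
have h1 := floor_le (x + u).
move: lt; rewrite floor_lt_int => h2.
apply/negP; rewrite -ltNge; apply: le_lt_trans h; rewrite ler_norml; lra.
Qed.

(** For [x = n alpha] and [M = n / t] rounded down, this is the count [G_n]. *)
Definition near_sum (R : realType) (M : nat) (x : R) : R :=
  \sum_(1 <= m < M.+1) near_int m x.

Lemma near_sumS (R : realType) (M : nat) (x : R) :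
  near_sum M.+1 x = near_sum M x + near_int M.+1 x.
Proof. by rewrite /near_sum big_nat_recr. Qed.

Lemma near_sum_ge0 (R : realType) (M : nat) (x : R) : 0 <= near_sum M x.
Proof. by apply: sumr_ge0 => m _; apply: near_int_ge0. Qed.

(** Every layer adds at most 1, except the first, whose interval of length 2 may hold two integers;
    hence the extra 1. Layers with [1 / m] below the distance add nothing. *)
Lemma near_sum_upper (R : realType) (M : nat) (x : R) : 0 < nearest_int_dist x ->
  near_sum M x <= 1 + M%:R /\ near_sum M x <= 1 + (nearest_int_dist x)^-1.
Proof.
set y := nearest_int_dist x => y0.
have Y2 : 2 <= y^-1.
  by rewrite -[2]invrK lef_pV2 ?posrE ?invr_gt0 // nearest_int_dist_le_half.
elim: M => [|M [IH1 IH2]].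
  rewrite /near_sum big_geq //; split; [|lra].
  by rewrite addr0 ler01.
rewrite near_sumS -natr1; case: M IH1 IH2 => [_ _|M IH1 IH2].
  rewrite /near_sum big_geq // add0r; have := near_int_le2 x; split; lra.
have h1 := near_int_le1 M x.
split; first lra.
have [h|h] := leP (M.+2%:R) y^-1.
  by move: h; rewrite -natr1; lra.
suff : near_int M.+2 x <= 0 by lra.
by apply: near_int_le0; rewrite -[ltRHS]invrK ltf_pV2 ?posrE ?invr_gt0 ?ltr0n.
Qed.

(** Every layer with [1 / m] above the distance [y] adds at least 1. The induction carries the
    alternative that all layers so far were of this kind or that [1 / y - 1] has already been
    reached. *)
Lemma near_sum_lower (R : realType) (M : nat) (x : R) : 0 < nearest_int_dist x ->
  (nearest_int_dist x)^-1 <= M%:R -> (nearest_int_dist x)^-1 - 1 <= near_sum M x.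
Proof.
set y := nearest_int_dist x => y0 yM.
suff [h|//] : M%:R <= near_sum M x \/ y^-1 - 1 <= near_sum M x by lra.
elim: M {yM} => [|M IH]; first by left; apply: near_sum_ge0.
have g0 := near_int_ge0 M.+1 x.
rewrite near_sumS -natr1; case: IH => h; last by right; lra.
have [hY|hY] := ltP (M.+1%:R) y^-1.
  have : 1 <= near_int M.+1 x; last by left; lra.
  by apply: near_int_ge1; rewrite -/y -[ltLHS]invrK ltf_pV2 ?posrE ?invr_gt0 ?ltr0n.
by right; move: hY; rewrite -natr1; lra.
Qed.

Lemma harmonic_div_ln (R : realType) n t : (0 < n)%N -> (0 < t)%N ->
  `| harmonic R (n %/ t) - ln n%:R | <= 1 + ln t%:R.
Proof.
move=> n0 t0.
have lt0 := ln_nat_ge0 R t; have ln0' := ln_nat_ge0 R n.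
rewrite ler_norml; apply/andP; split.
  have h1 := ln_le_harmonic R (n %/ t).
  have : ln (n%:R : R) <= ln ((n %/ t).+1%:R) + ln t%:R.
    rewrite -lnM ?posrE ?ltr0n // -natrM ln_nat_mono // ltnW // ltn_ceil //.
  lra.
case: (posnP (n %/ t)) => [->|h]; first by rewrite harmonic0; lra.
have h1 := harmonic_le_ln R h.
have := @ln_nat_mono R (n %/ t) n (leq_div _ _); lra.
Qed.

Lemma near_sum_average (R : realType) (alpha : R) n N : irrational alpha ->
  (0 < N)%N -> (N < cden alpha n.+1)%N -> (0 < cquot_sum alpha n)%N ->
  `| \sum_(1 <= i < N.+1) near_sum (i %/ cquot_sum alpha n) (i%:R * alpha) / i%:R
     - ln N%:R ^+ 2 | <= 16 * (1 + ln (cquot_sum alpha n)%:R) * harmonic R N.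
Proof.
move=> ia N0 Nq; set t := cquot_sum alpha n => t0.
pose f m i : R := near_int m (i%:R * alpha) - 2 * m%:R^-1.
have step1 : `| \sum_(1 <= i < N.+1) near_sum (i %/ t) (i%:R * alpha) / i%:R
   - \sum_(1 <= i < N.+1) 2 * harmonic R (i %/ t) / i%:R | <= 6 * harmonic R N.
  (* Interchanging the sums, layer [m] is present exactly for [i >= m t]. *)
  have -> : \sum_(1 <= i < N.+1) near_sum (i %/ t) (i%:R * alpha) / i%:R
     - \sum_(1 <= i < N.+1) 2 * harmonic R (i %/ t) / i%:R =
     \sum_(1 <= m < N.+1) \sum_(m * t <= i < N.+1) f m i / i%:R.
    rewrite -sumrB.
    transitivity (\sum_(1 <= i < N.+1) \sum_(1 <= m < N.+1 | (m <= i %/ t)%N) f m i / i%:R).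
      apply: eq_big_nat => i /andP[i1 iN].
      rewrite -mulrBl /near_sum /harmonic mulr_sumr -sumrB mulr_suml.
      rewrite (big_nat_widen _ _ N.+1) //.
      by apply: leq_trans iN; rewrite ltnS leq_div.
    rewrite (exchange_big_dep_nat xpredT) //=; apply: eq_big_nat => m /andP[m1 mN].
    rewrite [RHS](big_nat_widenl _ 1); last by rewrite muln_gt0 m1.
    by apply: eq_bigl => i /=; rewrite leq_divRL.
  apply: le_trans (ler_norm_sum _ _ _) _.
  rewrite /harmonic mulr_sumr; apply: ler_sum_nat => m /andP[m1 mN].
  have [le|gt] := leqP (m * t) N.+1; last first.
    by rewrite big_geq ?(ltnW gt) // normr0 mulr_ge0 // invr_ge0.
  have mt0 : (0 < m * t)%N by rewrite muln_gt0 m1.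
  have -> : 6 * m%:R^-1 = 6 * t%:R / (m * t)%:R :> R.
    by rewrite natrM; field; rewrite !pnatr_eq0 -!lt0n m1 t0.
  (* Partial sums are at most [6 t] by the window bound, and the range starts at [m t], so layer [m]
     costs [6 / m]. *)
  apply: abel_inequality => // j /andP[j1 j2].
  apply: near_int_window => //; apply: leq_ltn_trans Nq.
  by rewrite leq_subLR (leq_trans j2) // -add1n leq_add2r.
have step2 : `| \sum_(1 <= i < N.+1) 2 * harmonic R (i %/ t) / i%:R
   - \sum_(1 <= i < N.+1) 2 * ln (i%:R : R) / i%:R | <= 2 * (1 + ln t%:R) * harmonic R N.
  rewrite -sumrB; apply: le_trans (ler_norm_sum _ _ _) _.
  rewrite /harmonic mulr_sumr; apply: ler_sum_nat => i /andP[i1 iN].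
  rewrite -mulrBl -mulrBr !normrM normfV !normr_nat ler_wpM2r ?invr_ge0 //.
  by rewrite ler_wpM2l // harmonic_div_ln.
have step3 := sum_ln_div R N0.
have H0 := harmonic_ge0 R N.
have L0 := ln_nat_ge0 R t.
set X := \sum_(_ <= _ < _) _ in step1 *.
set Y := \sum_(_ <= _ < _) _ in step1 step2.
set Z := \sum_(_ <= _ < _) _ in step2 step3.
have -> : X - ln N%:R ^+ 2 = (X - Y) + (Y - Z) + (Z - ln N%:R ^+ 2) by ring.
apply: le_trans (ler_normD _ _) _; apply: le_trans (lerD (ler_normD _ _) (lexx _)) _.
(* The three errors have factors [6], [2 (1 + ln t)] and [8], together at most [16 (1 + ln t)]. *)
have : 0 <= ln t%:R * harmonic R N by rewrite mulr_ge0.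
lra.
Qed.

(** * One block of the sum *)

Lemma nearest_int_dist_gt0 (R : realType) (alpha : R) i : irrational alpha ->
  (0 < i)%N -> 0 < nearest_int_dist (i%:R * alpha).
Proof.
move=> ia i0; have [m [-> _ _]] := nearest_int_distP (i%:R * alpha).
rewrite normr_gt0 subr_eq0; apply/eqP => E; apply: ia.
have i0' : (i%:R : R) != 0 by rewrite pnatr_eq0 -lt0n.
exists (m%:~R / i%:R) => //.
by rewrite fmorph_div /= ratr_int ratr_nat -E mulrC mulKf.
Qed.

(** Reversed, the sum compares termwise with the harmonic one. For [J = Q] the last term is the
    inverse of 0, which is 0. *)
Lemma sum_inv_sub (R : realType) J Q : (J <= Q)%N ->
  \sum_(1 <= j < J.+1) ((Q - j)%N%:R)^-1 <= harmonic R J.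
Proof.
have lt_case K : (K < Q)%N -> \sum_(1 <= j < K.+1) ((Q - j)%N%:R)^-1 <= harmonic R K.
  move=> KQ; rewrite big_nat_rev /= /harmonic; apply: ler_sum_nat => j /andP[j1 jK].
  by rewrite lef_pV2 ?posrE ?ltr0n ?ler_nat //; lia.
rewrite leq_eqVlt => /orP[/eqP <-|]; last exact: lt_case.
case: J lt_case => [|J] h; first by rewrite big_geq // harmonic_ge0.
rewrite big_nat_recr //= subnn invr0 addr0.
apply: le_trans (harmonic_mono R (leqnSn J)); rewrite /harmonic big_nat_rev /=.
apply: ler_sum_nat => j /andP[j1 jK].
by rewrite lef_pV2 ?posrE ?ltr0n ?ler_nat //; lia.
Qed.

Lemma sum_inv_cut (R : realType) N T :
  \sum_(1 <= h < N.+1) (if (h <= T)%N then (h%:R)^-1 else 0) <= harmonic R T.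
Proof.
suff -> : \sum_(1 <= h < N.+1) (if (h <= T)%N then (h%:R)^-1 else 0) = harmonic R (minn N T).
  by rewrite harmonic_mono // geq_minr.
elim: N => [|N IH]; first by rewrite big_geq // min0n harmonic0.
rewrite big_nat_recr //= IH; case: leqP => h.
  by rewrite addr0 (minn_idPr _) // leqW.
by rewrite (minn_idPl h) harmonicS.
Qed.

(** A majorant of [1 / |z|] for nonzero [z] in the class of [h] modulo [q] with [|z| <= T]; the
    summands stand for the representatives [h] and [h - q]. At [h = 0] the first one is the inverse
    of 0, that is 0. *)
Definition residue_weight (R : realType) (q T h : nat) : R :=
  (if (h <= T)%N then (h%:R)^-1 else 0) +
  (if (q - h <= T)%N then ((q - h)%N%:R)^-1 else 0).

Lemma residue_weight_ge0 (R : realType) q T h : 0 <= residue_weight R q T h.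
Proof. by rewrite addr_ge0 //; case: ifP => _ //; rewrite invr_ge0. Qed.

Lemma sum_residue_weight (R : realType) q T : (0 < q)%N ->
  \sum_(0 <= h < q) residue_weight R q T h <= 2 * harmonic R T.
Proof.
case: q => // q _; rewrite /residue_weight big_split /= mulrDl mul1r; apply: lerD.
  by rewrite big_ltn // leq0n invr0 add0r; apply: sum_inv_cut.
rewrite -[q.+1]/(q.+1)%N big_nat_rev /= add0n.
rewrite (eq_big_nat _ _ (F2 := fun h => if (h.+1 <= T)%N then (h.+1%:R)^-1 else 0)); last first.
  by move=> h /andP[_ hq]; rewrite subKn.
have := sum_inv_cut R q.+1 T.
by rewrite -{1}[1%N]add0n big_addn subn1 /=; under eq_bigr do rewrite addn1.
Qed.

Lemma residue_weight_bound (R : realType) (q T : nat) (z x : int) : (0 < q)%N ->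
  z != 0 -> (`|z| <= T)%N -> (z = x %[mod q])%Z ->
  (`|z|%N%:R)^-1 <= residue_weight R q T `|(x %% q)%Z|%N.
Proof.
move=> q0 z0 zT <-; set h := `|(z %% q)%Z|%N.
have hE : h%:Z = (z %% q)%Z by rewrite gez0_abs // modz_ge0 // -lt0n.
have hq : (h < q)%N by rewrite -ltz_nat hE ltz_pmod.
have zE := divz_eq z q; rewrite -hE in zE.
have case_le k : (0 < k <= `|z|)%N -> (`|z|%N%:R)^-1 <=
    (if (k <= T)%N then (k%:R)^-1 else 0 : R).
  move=> /andP[k0 kz]; rewrite (leq_trans kz zT).
  by rewrite lef_pV2 ?posrE ?ltr0n ?ler_nat // absz_gt0.
have w1 : 0 <= (if (h <= T)%N then (h%:R)^-1 else 0) :> R.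
  by case: ifP => _ //; rewrite invr_ge0.
have w2 : 0 <= (if (q - h <= T)%N then ((q - h)%N%:R)^-1 else 0) :> R.
  by case: ifP => _ //; rewrite invr_ge0.
rewrite /residue_weight; set d := (z %/ q)%Z in zE.
have [small|large] := boolP ((0 < h) && (h <= `|z|))%N.
  by apply: le_trans (case_le _ small) _; rewrite lerDl.
(* Otherwise [h = 0] or [|z| < h], and both force [|z| >= q - h]. *)
apply: le_trans (case_le (q - h)%N _) _; last by rewrite lerDr.
have d_cases : [\/ d * q%:Z <= - q%:Z, d = 0 | q%:Z <= d * q%:Z].
  case: (ltgtP d 0) => hd; first by constructor 1; nia.
    by constructor 3; nia.
  by constructor 2.
move: zE z0 large; rewrite /h; clearbody h d; clear -hq d_cases q0 => zE z0 large.
by case: d_cases => hd; [|rewrite hd mul0r add0r in zE|];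
  move: large zE z0 hd; move: (d * q%:Z) => e; lia.
Qed.

(** This is [q_(n+1) d_n <= 1], in the form that bounds the wrap-around distance [1 - i d_n] from
    below. *)
Lemma cden_cdist_lt (R : realType) (alpha : R) n i : irrational alpha ->
  (i < cden alpha n.+2)%N ->
  ((cden alpha n.+2)%:R - i%:R) * cdist alpha n.+1 <= 1 - i%:R * cdist alpha n.+1.
Proof.
move=> ia lt; have := cden_cdist n.+1 ia.
have : 0 <= (cden alpha n.+1)%:R * cdist alpha n.+2.
  by rewrite mulr_ge0 // ltW // cdist_gt0.
by rewrite mulrBl; set u := _ * cdist alpha n.+2; set v := _ * cdist alpha n.+1; lra.
Qed.

(** Expanding [q_(n+1)] in [q_(n+1) d_n + q_n d_(n+1) = 1] gives [a_(n+1) q_n d_n] plus two terms,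
    each between 0 and [q_n d_n]. *)
Lemma inv_cden_cdist (R : realType) (alpha : R) n : irrational alpha ->
  (cquot alpha n.+1)%:R <= ((cden alpha n.+1)%:R * cdist alpha n.+1)^-1
    <= (cquot alpha n.+1)%:R + 2.
Proof.
move=> ia.
have q0 : (0 : R) < (cden alpha n.+1)%:R by rewrite ltr0n cden_gt0.
have d0 := cdist_gt0 n.+1 ia; have d1 := cdist_gt0 n.+2 ia.
have d2 := cdist_leS n.+1 ia.
have q1 : (cden alpha n)%:R <= (cden alpha n.+1)%:R :> R by rewrite ler_nat cden_leS.
have E := cden_cdist n.+1 ia; rewrite cdenSS // natrD natrM in E.
have q2 : 0 <= (cden alpha n)%:R :> R by [].
have a0 : 0 <= (cquot alpha n.+1)%:R :> R by [].
move: (cden alpha n.+1)%:R (cden alpha n)%:R (cquot alpha n.+1)%:R (cdist alpha n.+1)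
  (cdist alpha n.+2) q0 d0 d1 d2 q1 E q2 a0 => q q' a d d' q0 d0 d1 d2 q1 E q2 a0.
have qd : 0 < q * d by rewrite mulr_gt0.
have h1 : 0 <= q' * d by rewrite mulr_ge0 // ltW.
have h2 : 0 <= q * d' by rewrite mulr_ge0 // ltW.
have h3 : q' * d <= q * d by rewrite ler_wpM2r // ltW.
have h4 : q * d' <= q * d by rewrite ler_wpM2l // ltW.
apply/andP; split.
  by rewrite -[leRHS]mul1r ler_pdivlMr //; lra.
by rewrite -[leLHS]mul1r ler_pdivrMr //; lra.
Qed.

Lemma special_term (R : realType) (alpha : R) n j : irrational alpha ->
  (0 < j)%N -> (j * cden alpha n.+1 < cden alpha n.+2)%N ->
  `| ((j * cden alpha n.+1)%N%:R *
        nearest_int_dist ((j * cden alpha n.+1)%N%:R * alpha))^-1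
     - (cquot alpha n.+1)%:R / j%:R ^+ 2 |
  <= 2 * (j%:R ^+ 2)^-1 + 2 * j%:R^-1 + 2 * ((cden alpha n.+2 - j)%N%:R)^-1.
Proof.
move=> ia j0 jq; have y0 := @nearest_int_dist_gt0 _ alpha (j * cden alpha n.+1) ia.
have {}y0 := y0 (ltac:(by rewrite muln_gt0 j0 cden_gt0)).
have lt := cden_cdist_lt ia jq; move: y0 lt.
have jQ : (j < cden alpha n.+2)%N by apply: leq_ltn_trans jq; rewrite leq_pmulr // cden_gt0.
have ltj := cden_cdist_lt ia jQ.
have A := inv_cden_cdist n ia.
have Q0 : (0 : R) < (cden alpha n.+2)%:R by rewrite ltr0n cden_gt0.
have D2 := cdist_geV n.+1 ia.
have E := cden_mul n.+1 ia.
set x := _ * alpha.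
have xE : x = (j%:Z * cnum alpha n.+1)%:~R - (-1) ^+ n.+1 * (j%:R * cdist alpha n.+1).
  by rewrite /x natrM -mulrA E intrM; ring.
have [m [yE _ ymin]] := nearest_int_distP x.
have up : nearest_int_dist x <= j%:R * cdist alpha n.+1.
  apply: le_trans (ymin (j%:Z * cnum alpha n.+1)) _.
  rewrite xE addrAC subrr add0r normrN normrM normrX normrN1 expr1n mul1r ger0_norm //.
  by rewrite mulr_ge0 // ltW // cdist_gt0.
(* Either [j p] is nearest to [x], or another integer is, and that one is at least [1 - j d]
   away. *)
have low : nearest_int_dist x = j%:R * cdist alpha n.+1 \/
    1 - j%:R * cdist alpha n.+1 <= nearest_int_dist x.
  have jd0 : 0 <= j%:R * cdist alpha n.+1 by rewrite mulr_ge0 // ltW // cdist_gt0.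
  have -> : nearest_int_dist x =
    `| (j%:Z * cnum alpha n.+1 - m)%:~R - (-1) ^+ n.+1 * (j%:R * cdist alpha n.+1)|.
    by rewrite yE xE intrB; congr `|_|; ring.
  set z := (_ - m : int); have [->|z0] := eqVneq z 0.
    by left; rewrite sub0r normrN normrM normrX normrN1 expr1n mul1r ger0_norm.
  right; apply: le_trans (lerB_dist _ _).
  rewrite [X in _ <= _ - X]normrM normrX normrN1 expr1n mul1r [X in _ <= _ - X]ger0_norm //.
  by rewrite lerD2r -intr_norm (ler_int R 1); lia.
move: up low; move: (nearest_int_dist x) => y up low y0 _.
have q1 : (1 : R) <= (cden alpha n.+1)%:R by rewrite ler1n cden_gt0.
have j1 : (1 : R) <= j%:R by rewrite ler1n.
have jQ' : (j%:R : R) < (cden alpha n.+2)%:R by rewrite ltr_nat.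
have d0 := cdist_gt0 n.+1 ia.
rewrite natrM natrB; last exact: ltnW.
move: (cden alpha n.+1)%:R (cden alpha n.+2)%:R (cquot alpha n.+1)%:R (cdist alpha n.+1)
  j%:R {jq j0 jQ xE E ymin yE x} ltj A Q0 D2 up low y0 q1 j1 jQ' d0
  => q Q a d t ltj A Q0 D2 up low y0 q1 t1 tQ d0.
have tpos : 0 < t by lra.
have qpos : 0 < q by lra.
have main0 : `| (t ^+ 2 * (q * d))^-1 - a / t ^+ 2 | <= 2 * (t ^+ 2)^-1.
  have -> : (t ^+ 2 * (q * d))^-1 - a / t ^+ 2 = ((q * d)^-1 - a) * (t ^+ 2)^-1.
    by field; rewrite !gt_eqF //; lra.
  have t2 : 0 <= (t ^+ 2)^-1 by rewrite invr_ge0 sqr_ge0.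
  rewrite normrM [X in _ * X]ger0_norm // ler_wpM2r // ler_norml; lra.
have main1 : `| (t * q * y)^-1 - (t ^+ 2 * (q * d))^-1 | <= 2 * t^-1 + 2 * (Q - t)^-1.
  have r0 : 0 <= 2 * t^-1 + 2 * (Q - t)^-1.
    by rewrite addr_ge0 // mulr_ge0 // invr_ge0; lra.
  case: low => [->|low].
    by rewrite [X in `|X|](_ : _ = 0) ?normr0 //; field; rewrite !gt_eqF //; lra.
  have Qd : 0 < (Q - t) * d by rewrite mulr_gt0 // subr_gt0.
  have tq : 0 < t * q by apply: mulr_gt0; lra.
  have h1 : (t ^+ 2 * (q * d))^-1 <= (t * q * y)^-1.
    rewrite lef_pV2 ?posrE ?mulr_gt0 ?exprn_gt0 //; try lra.
    rewrite [leRHS](_ : _ = t * q * (t * d)); last by ring.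
    by rewrite ler_pM2l.
  (* In the wrap-around case [y >= (Q - j) d]. With [2 Q d >= 1] the whole term is at most
     [2 Q / (j (Q - j))], which splits into the two fractions. *)
  have h2 : (t * q * y)^-1 <= 2 * t^-1 + 2 * (Q - t)^-1.
    have d1 : 1 <= 2 * Q * d.
      by rewrite mulrC -ler_pdivrMr ?mulr_gt0 // mul1r.
    have -> : 2 * t^-1 + 2 * (Q - t)^-1 = 2 * Q / (t * (Q - t)).
      by field; rewrite !gt_eqF //; lra.
    rewrite -[leLHS]mul1r ler_pdivrMr ?mulr_gt0 //.
    rewrite mulrAC ler_pdivlMr ?mulr_gt0 //; try lra.
    rewrite mul1r.
    apply: le_trans (_ : t * (Q - t) * (2 * Q * d) <= _).
      by rewrite -[leLHS]mulr1 ler_wpM2l // mulr_ge0; lra.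
    have -> : t * (Q - t) * (2 * Q * d) = 2 * Q * (t * 1 * ((Q - t) * d)) by ring.
    rewrite ler_wpM2l //; first by rewrite mulr_ge0 // ltW.
    apply: ler_pM; [by rewrite mulr1; lra|exact: ltW| |lra].
    by rewrite ler_wpM2l //; lra.
  by rewrite ger0_norm ?subr_ge0 // lerBlDr (le_trans h2) // lerDl invr_ge0 !mulr_ge0 //; lra.
have -> : (t * q * y)^-1 - a / t ^+ 2 =
  ((t * q * y)^-1 - (t ^+ 2 * (q * d))^-1) + ((t ^+ 2 * (q * d))^-1 - a / t ^+ 2) by ring.
by apply: le_trans (ler_normD _ _) _; lra.
Qed.

(** With [m] nearest to [i alpha] and [z = i p - m q], one has [q y = |z + (-1)^n i d|] where
    [0 <= i d < 1]. Equal signs cause no loss and [|z| >= 2] loses at most half; only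
    [(-1)^n z = -1] can nearly cancel, and it pins down [i] modulo [q]. *)
Lemma nonspecial_lower (R : realType) (alpha : R) n i : irrational alpha ->
  (i < cden alpha n.+2)%N -> ~~ (cden alpha n.+1 %| i)%N ->
  let y := nearest_int_dist (i%:R * alpha) in
  exists z : int, [/\ z != 0, (z = i%:Z * cnum alpha n.+1 %[mod cden alpha n.+1])%Z &
    `|z|%N%:R <= 2 * ((cden alpha n.+1)%:R * y) \/
    (i = cden alpha n %[mod cden alpha n.+1])%N /\
      ((cden alpha n.+2)%:R - i%:R) * cdist alpha n.+1 <= (cden alpha n.+1)%:R * y].
Proof.
move=> ia iQ ndv /=.
have q0 : (0 < cden alpha n.+1)%N by rewrite cden_gt0.
have E := cden_mul n.+1 ia; have det := cnum_det n ia.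
have cop := cnum_coprime n ia; have lt := cden_cdist_lt ia iQ.
have d0 := cdist_gt0 n.+1 ia; have Q1 := cden_cdist n.+1 ia.
have Q2 : 0 <= (cden alpha n.+1)%:R * cdist alpha n.+2.
  by rewrite mulr_ge0 // ltW // cdist_gt0.
have iQ' : i%:R + 1 <= (cden alpha n.+2)%:R :> R by rewrite natr1 ler_nat.
have [m [-> _ _]] := nearest_int_distP (i%:R * alpha).
set q := cden alpha n.+1 in q0 E det cop Q2 ndv *; set p := cnum alpha n.+1 in E det cop *.
set q' := cden alpha n in det *; set Q := cden alpha n.+2 in lt iQ' Q1 *.
set d := cdist alpha n.+1 in E lt d0 Q1 *.
have id1 : i%:R * d < 1 by nra.
have id0 : 0 <= i%:R * d by rewrite mulr_ge0 // ltW.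
have qyE : q%:R * `|i%:R * alpha - m%:~R| =
    `|(i%:Z * p - m * q%:Z)%:~R + (-1) ^+ n * (i%:R * d)|.
  rewrite -[X in X * _](ger0_norm (ler0n R q)) -normrM; congr `|_|.
  have -> : q%:R * (i%:R * alpha - m%:~R) = i%:R * (q%:R * alpha) - m%:~R * q%:R by ring.
  by rewrite E intrB !intrM exprS; ring.
set z := i%:Z * p - m * q%:Z in qyE *; rewrite qyE.
have z0 : z != 0.
  apply/eqP => z0; move/negP: ndv; apply.
  have : (q%:Z %| p * i%:Z)%Z by apply/dvdzP; exists m; rewrite mulrC; lia.
  by rewrite Gauss_dvdzr // coprimez_sym.
exists z; split=> //; first by apply/eqP; rewrite eqz_mod_dvd; apply/dvdzP; exists (- m); rewrite /z; ring.
have sgn : (-1) ^+ n = 1 :> int /\ (-1) ^+ n = 1 :> R \/ (-1) ^+ n = -1 :> int /\ (-1) ^+ n = -1 :> R.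
  by rewrite -(signr_odd R n) -(signr_odd int n); case: odd; [right | left].
(* The determinant identity makes [z q' + (-1)^n i] a multiple of [q]; multiplying by [(-1)^n] turns
   it into [i - q']. *)
have bad : (-1) ^+ n * z = -1 -> (i = q' %[mod q])%N.
  move=> Ez; apply/eqP; rewrite -eqz_nat -!modz_nat.
  rewrite eqz_mod_dvd; apply/dvdzP.
  exists ((-1) ^+ n * (i%:Z * cnum alpha n - m * q'%:Z)).
  have s2 : (-1) ^+ n * (-1) ^+ n = 1 :> int by rewrite -expr2 sqrr_sign.
  have k1 : z * q'%:Z + (-1) ^+ n * i%:Z = q%:Z * (i%:Z * cnum alpha n - m * q'%:Z).
    rewrite /z; transitivity (i%:Z * (p * q'%:Z + (-1) ^+ n) - m * q%:Z * q'%:Z); first by ring.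
    by rewrite -[(-1) ^+ n]opprK -det; ring.
  rewrite -mulrA [X in _ * X]mulrC -k1 mulrDr !mulrA Ez s2; ring.
have [szge|] := leP 1 ((-1) ^+ n * z).
  left; case: sgn => [[s1 s2]|[s1 s2]]; rewrite s1 ?s2 in szge *.
    have zz : (1 : R) <= z%:~R by rewrite (ler_int R 1); lia.
    rewrite pmulrn gez0_abs; last lia.
    by rewrite ger0_norm; lra.
  have zz : z%:~R <= (-1 : R) by rewrite -[-1]/((-1)%:~R) ler_int; lia.
  rewrite pmulrn lez0_abs; last lia.
  by rewrite ler0_norm ?intrN; lra.
move=> szlt; have [Ez|nEz] := eqVneq ((-1) ^+ n * z) (-1).
  right; split; first exact: bad.
  apply: le_trans lt _.
  case: sgn => [[s1 s2]|[s1 s2]]; rewrite s1 ?s2 in Ez *.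
    have -> : z = -1 by lia.
    by rewrite ler0_norm ?mulrN1z; lra.
  have -> : z = 1 by lia.
  by rewrite ger0_norm ?mulr1z; lra.
left; case: sgn => [[s1 s2]|[s1 s2]]; rewrite s1 ?s2 in szlt nEz *.
  have zz : z%:~R <= (-2 : R) by rewrite -[-2]/((-2)%:~R) ler_int; lia.
  rewrite pmulrn lez0_abs; last lia.
  by rewrite ler0_norm ?intrN; lra.
have zz : (2 : R) <= z%:~R by rewrite (ler_int R 2); lia.
rewrite pmulrn gez0_abs; last lia.
by rewrite ger0_norm; lra.
Qed.

(** * Excess of the summands over their truncations *)

Definition excess (R : realType) (alpha : R) (t i : nat) : R :=
  (i%:R * nearest_int_dist (i%:R * alpha))^-1 - near_sum (i %/ t) (i%:R * alpha) / i%:R.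

Lemma excess_bound (R : realType) (alpha : R) t i : irrational alpha ->
  (0 < i)%N -> (0 < t)%N ->
  `|excess alpha t i| <= 2 * i%:R^-1 +
    (if i%:R * nearest_int_dist (i%:R * alpha) < 2 * t%:R
     then (i%:R * nearest_int_dist (i%:R * alpha))^-1 else 0).
Proof.
move=> ia i0 t0; have y0 := nearest_int_dist_gt0 ia i0.
rewrite /excess; have [u1 u2] := near_sum_upper (i %/ t) y0.
have low := @near_sum_lower R (i %/ t) _ y0.
have g0 := near_sum_ge0 (i %/ t) (i%:R * alpha).
have yh := nearest_int_dist_le_half (i%:R * alpha).
set y := nearest_int_dist _ in y0 u1 u2 low yh *; set G := near_sum _ _ in u1 u2 low g0 *.
have iR : (0 : R) < i%:R by rewrite ltr0n.
have tR : (0 : R) < t%:R by rewrite ltr0n.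
have iM : i%:R < ((i %/ t)%N%:R + 1) * t%:R :> R.
  by rewrite natr1 -natrM ltr_nat ltn_ceil.
have Y0 : 0 < y^-1 by rewrite invr_gt0.
have i1 : 0 < i%:R^-1 :> R by rewrite invr_gt0.
have -> : (i%:R * y)^-1 - G / i%:R = (y^-1 - G) * i%:R^-1 by rewrite invfM; ring.
rewrite normrM [X in _ * X]ger0_norm ?(ltW i1) //.
have [YM|MY] := leP y^-1 (i %/ t)%N%:R.
  have h : `|y^-1 - G| <= 1 by rewrite ler_norml; have := low YM; lra.
  apply: le_trans (ler_wpM2r (ltW i1) h) _.
  have h2 : 0 <= (if i%:R * y < 2 * t%:R then (i%:R * y)^-1 else 0).
    by case: ifP => _ //; rewrite invr_ge0 mulr_ge0 // ltW.
  by lra.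
(* Here [1 / y] exceeds [i / t] rounded down, and [y <= 1 / 2] pays for the rounding: [i y] is below
   [(1 + 1 / 2) t]. *)
have -> : i%:R * y < 2 * t%:R.
  have My : (i %/ t)%N%:R * y < 1 by rewrite -ltr_pdivlMr // mul1r.
  have h : i%:R * y < ((i %/ t)%N%:R + 1) * t%:R * y by rewrite ltr_pM2r.
  apply: lt_le_trans h _.
  have -> : ((i %/ t)%N%:R + 1) * t%:R * y = ((i %/ t)%N%:R * y + y) * t%:R by ring.
  by rewrite ler_pM2r //; lra.
have h : `|y^-1 - G| <= 2 + y^-1 by rewrite ler_norml; lra.
apply: le_trans (ler_wpM2r (ltW i1) h) _.
by rewrite invfM; lra.
Qed.

Lemma sum_multiples (R : realType) (f : nat -> R) q X : (0 < q)%N ->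
  \sum_(1 <= i < X.+1 | (q %| i)%N) f i = \sum_(1 <= j < (X %/ q).+1) f (j * q)%N.
Proof.
move=> q0; elim: X => [|X IH]; first by rewrite div0n !big_geq.
rewrite big_mkcond big_nat_recr //= -big_mkcond IH divnS //.
case: ifP => [dv|ndv] /=; last by rewrite add0n addr0.
rewrite add1n [RHS]big_nat_recr //=; congr (_ + f _).
by have := divnK dv; rewrite divnS // dv add1n => ->.
Qed.

Lemma sum_blocks_le (R : realType) (f : nat -> R) q X J : (forall i, 0 <= f i) ->
  (q <= X)%N -> (X <= J.+1 * q)%N ->
  \sum_(q <= i < X) f i <= \sum_(1 <= j < J.+1) \sum_(0 <= r < q) f (j * q + r)%N.
Proof.
move=> f0 qX XJ.
apply: le_trans (_ : \sum_(q <= i < J.+1 * q) f i <= _).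
  by rewrite [leRHS](@big_cat_nat _ _ _ X) //= lerDl sumr_ge0.
have E := big_nat_mul +%R J.+1 q f.
rewrite [RHS]big_ltn // mul0n mul1n in E.
rewrite (@big_cat_nat _ _ _ q) //= in E; last by rewrite leq_pmull.
move/addrI: E => ->; apply: ler_sum_nat => j _.
rewrite -{1}[(j * q)%N]add0n big_addn mulSn addnK.
by rewrite (eq_bigr (fun r => f (j * q + r)%N)) // => r _; rewrite addnC.
Qed.

(** The two summands majorize [1 / (i y)] in the two cases of [nonspecial_lower]; the second case
    concerns a single residue class modulo the denominator. *)
Definition block_weight (R : realType) (alpha : R) (n t i : nat) : R :=
  2 / (i %/ cden alpha n.+1)%N%:R *
    residue_weight R (cden alpha n.+1) (4 * t)
      `|((i%:Z * cnum alpha n.+1) %% cden alpha n.+1)%Z|%N +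
  (if (i %% cden alpha n.+1 == cden alpha n %% cden alpha n.+1)%N
   then 2 / (i %/ cden alpha n.+1)%N%:R
      + 2 / (cquot alpha n.+1 - i %/ cden alpha n.+1)%N%:R else 0).

Lemma block_weight_ge0 (R : realType) (alpha : R) n t i : 0 <= block_weight alpha n t i.
Proof.
apply: addr_ge0; first by rewrite mulr_ge0 ?divr_ge0 // residue_weight_ge0.
by case: ifP => _ //; rewrite addr_ge0 // divr_ge0.
Qed.

Lemma nonspecial_term (R : realType) (alpha : R) n t i : irrational alpha ->
  (0 < t)%N -> (cden alpha n.+1 <= i < cden alpha n.+2)%N ->
  ~~ (cden alpha n.+1 %| i)%N ->
  `|excess alpha t i| <= 2 * i%:R^-1 + block_weight alpha n t i.
Proof.
move=> ia t0 /andP[qi iQ] ndv.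
have q0 : (0 < cden alpha n.+1)%N by rewrite cden_gt0.
have i0 : (0 < i)%N by apply: leq_trans qi.
apply: le_trans (excess_bound ia i0 t0) _; rewrite lerD2l.
have y0 := nearest_int_dist_gt0 ia i0.
have [z [z0 zmod zcase]] := nonspecial_lower ia iQ ndv.
set y := nearest_int_dist _ in y0 zcase *.
case: ifP => [iyt|_]; last exact: block_weight_ge0.
have D2 := cdist_geV n.+1 ia; have d0 := cdist_gt0 n.+1 ia.
rewrite /block_weight; set q := cden alpha n.+1 in q0 qi ndv zmod zcase *.
set j := (i %/ q)%N.
have j0 : (0 < j)%N by rewrite divn_gt0.
have qR : (0 : R) < q%:R by rewrite ltr0n.
have jR : (0 : R) < j%:R by rewrite ltr0n.
have iR : (0 : R) < i%:R by rewrite ltr0n.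
have jqi : j%:R * q%:R <= i%:R :> R by rewrite -natrM ler_nat leq_trunc_div.
case: zcase => [zy|[imod low]].
  have zR : (0 : R) < `|z|%N%:R by rewrite ltr0n absz_gt0.
  have jy : j%:R * q%:R * y <= i%:R * y by rewrite ler_wpM2r // ltW.
  (* The cut-off [4 t] arises from [|z| <= 2 q y <= 2 i y < 4 t]. *)
  have zT : (`|z| <= 4 * t)%N.
    rewrite -(ler_nat R) natrM.
    have j1 : (1 : R) <= j%:R by rewrite ler1n.
    have h0 : q%:R * y <= j%:R * (q%:R * y) by rewrite ler_peMl // mulr_ge0 // ltW.
    by rewrite mulrA in h0; lra.
  have W := residue_weight_bound R q0 z0 zT zmod.
  apply: le_trans (_ : 2 / j%:R * (`|z|%N%:R)^-1 <= _); last first.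
    apply: ler_wpDr; last by rewrite ler_wpM2l // divr_ge0.
    by case: ifP => _ //; rewrite addr_ge0 // divr_ge0.
  rewrite -[leLHS]mul1r ler_pdivrMr ?mulr_gt0 //.
  have -> : 2 / j%:R / `|z|%N%:R * (i%:R * y) = 2 * (i%:R * y) / (j%:R * `|z|%N%:R).
    by field; rewrite !gt_eqF.
  rewrite ler_pdivlMr ?mulr_gt0 // mul1r.
  have h0 : j%:R * `|z|%N%:R <= j%:R * (2 * (q%:R * y)) by rewrite ler_wpM2l // ltW.
  have -> : 2 * (i%:R * y) = (i%:R * y) + (i%:R * y) by ring.
  have E : j%:R * (2 * (q%:R * y)) = j%:R * q%:R * y + j%:R * q%:R * y by ring.
  by rewrite E in h0; apply: le_trans h0 _; rewrite lerD.
rewrite imod eqxx.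
have W0 : 0 <= 2 / j%:R * residue_weight R q (4 * t) `|((i%:Z * cnum alpha n.+1) %% q)%Z|%N.
  by rewrite mulr_ge0 ?divr_ge0 // residue_weight_ge0.
apply: le_trans (_ : 2 / j%:R + 2 / (cquot alpha n.+1 - j)%N%:R <= _); last by rewrite lerDr.
have QE := cdenSS n ia; rewrite -/q in QE.
have q'q : (cden alpha n <= q)%N := cden_leS n ia.
have q'lt : (cden alpha n < q)%N.
  rewrite ltn_neqAle q'q andbT; apply/eqP => E.
  by move: ndv; rewrite /dvdn imod E modnn.
have iE : (i = j * q + cden alpha n)%N by rewrite {1}(divn_eq i q) imod modn_small.
(* Since [i < q_(n+1) = a q_n + q_(n-1)], the difference [a - j] is positive and is not truncated to
   0. *)
have ja : (j < cquot alpha n.+1)%N.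
  by move: iQ; rewrite QE iE ltn_add2r ltn_pmul2r.
have QiE : (cden alpha n.+2)%:R - i%:R = (cquot alpha n.+1 - j)%N%:R * q%:R :> R.
  by rewrite QE iE natrB 1?ltnW // !natrD !natrM; ring.
rewrite QiE in low.
have QR : (0 : R) < (cden alpha n.+2)%:R by rewrite ltr0n cden_gt0.
have bR : (0 : R) < (cquot alpha n.+1 - j)%N%:R by rewrite ltr0n subn_gt0.
set b := (cquot alpha n.+1 - j)%N%:R in QiE low bR *.
set Q := (cden alpha n.+2)%:R in D2 QiE QR *.
set d := cdist alpha n.+1 in D2 d0 low *.
have by_ : b * d <= y.
  by rewrite -(ler_pM2l qR); apply: le_trans low; rewrite mulrAC mulrC.
have d1 : 1 <= 2 * Q * d by rewrite mulrC -ler_pdivrMr ?mulr_gt0 // mul1r.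
rewrite -[leLHS]mul1r ler_pdivrMr ?mulr_gt0 //.
apply: le_trans d1 _.
(* From [1 <= 2 Q d] and [y >= b d], the claim reduces to [j q <= i]. *)
have -> : Q = i%:R + b * q%:R by rewrite -QiE; ring.
have -> : 2 / j%:R + 2 / b = 2 * (b + j%:R) / (j%:R * b) by field; rewrite !gt_eqF.
rewrite [leRHS]mulrAC ler_pdivlMr ?mulr_gt0 //.
apply: le_trans (_ : 2 * (b + j%:R) * (i%:R * (b * d)) <= _); last first.
  by rewrite ler_wpM2l ?mulr_ge0 ?ler_wpM2l ?addr_ge0 // ltW.
have -> : 2 * (i%:R + b * q%:R) * d * (j%:R * b) =
  2 * (b * d) * (i%:R * j%:R + b * (j%:R * q%:R)) by ring.
have -> : 2 * (b + j%:R) * (i%:R * (b * d)) = 2 * (b * d) * (i%:R * j%:R + b * i%:R) by ring.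
by rewrite ler_wpM2l ?lerD2l ?ler_wpM2l ?mulr_ge0 // ltW.
Qed.

(** Within a block the residues of [i p] modulo [q] form a permutation, and exactly one [i] lies in
    the exceptional class. *)
Lemma sum_block_weight (R : realType) (alpha : R) n t j : irrational alpha ->
  (0 < j)%N ->
  \sum_(0 <= r < cden alpha n.+1) block_weight alpha n t (j * cden alpha n.+1 + r)%N
  <= 4 * harmonic R (4 * t) / j%:R
     + (2 / j%:R + 2 / (cquot alpha n.+1 - j)%N%:R).
Proof.
move=> ia j0; have q0 : (0 < cden alpha n.+1)%N by rewrite cden_gt0.
rewrite /block_weight; have cop := cnum_coprime n ia.
set q := cden alpha n.+1 in q0 cop *; set p := cnum alpha n.+1 in cop *.
set B := 2 / j%:R + 2 / (cquot alpha n.+1 - j)%N%:R.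
rewrite (eq_big_nat _ _ (F2 := fun r : nat =>
  2 / j%:R * residue_weight R q (4 * t) `|((0 + r%:Z * p) %% q)%Z|%N
  + (if r == (cden alpha n %% q)%N then B else 0))); last first.
  move=> r /andP[_ rq]; rewrite divnMDl // divn_small // addn0 modnMDl (modn_small rq).
  have -> : (j * q + r)%N%:Z * p = (j%:Z * p) * q%:Z + r%:Z * p by rewrite PoszD PoszM; ring.
  by rewrite add0r modzMDl.
rewrite big_split /= -mulr_sumr (modz_permutation 0 _ q0 cop); apply: lerD.
  have -> : 4 * harmonic R (4 * t) / j%:R = 2 / j%:R * (2 * harmonic R (4 * t)) by ring.
  by rewrite ler_wpM2l ?divr_ge0 // sum_residue_weight.
by rewrite -big_mkcond big_nat1_eq /= ltn_mod q0.
Qed.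

Lemma block_sum (R : realType) (alpha : R) n t X : irrational alpha ->
  (cquot alpha n.+1 <= t)%N ->
  (cden alpha n.+1 <= X <= cden alpha n.+2)%N ->
  `| \sum_(cden alpha n.+1 <= i < X) excess alpha t i
     - (cquot alpha n.+1)%:R * \sum_(1 <= j < (X.-1 %/ cden alpha n.+1).+1) (j%:R ^+ 2)^-1 |
  <= 5 + (7 + 4 * harmonic R (4 * t)) * harmonic R (X.-1 %/ cden alpha n.+1)
     + 2 * harmonic R (cquot alpha n.+1)
     + 2 * \sum_(cden alpha n.+1 <= i < X) i%:R^-1.
Proof.
move=> ia at_ /andP[qX XQ]; set J := (X.-1 %/ _)%N.
have q0 : (0 < cden alpha n.+1)%N by rewrite cden_gt0.
have a0 := cquot_gt0 n ia.
have t0 : (0 < t)%N by apply: leq_trans at_.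
have X0 : (0 < X)%N by apply: leq_trans qX.
have XE : X = X.-1.+1 by rewrite prednK.
have Jq : (J * cden alpha n.+1 <= X.-1)%N by rewrite leq_trunc_div.
have JQ : (J * cden alpha n.+1 < cden alpha n.+2)%N.
  by apply: leq_trans XQ; rewrite XE ltnS.
have Ja : (J <= cquot alpha n.+1)%N.
  rewrite -ltnS -(ltn_pmul2r q0); apply: leq_trans JQ _.
  by rewrite cdenSS // mulSn addnC leq_add2r cden_leS.
set q := cden alpha n.+1 in q0 qX Jq JQ *; set a := cquot alpha n.+1 in a0 at_ Ja *.
(* Multiples of [q] carry the main term; all other indices form the error [S]. *)
rewrite (bigID (fun i => (q %| i)%N)) /=.
set S := \sum_(_ <= _ < _ | ~~ _) _.
have Sbound : `|S| <= 2 * \sum_(q <= i < X) i%:R^-1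
    + (4 * harmonic R (4 * t) * harmonic R J + 2 * harmonic R J + 2 * harmonic R a).
  apply: le_trans (ler_norm_sum _ _ _) _.
  apply: le_trans (_ : \sum_(q <= i < X) (2 * i%:R^-1 + block_weight alpha n t i) <= _).
    rewrite big_mkcond /=; apply: ler_sum_nat => i /andP[i1 i2].
    case: ifP => ndv; last by rewrite addr_ge0 ?block_weight_ge0 // mulr_ge0 // invr_ge0.
    by apply: nonspecial_term => //; rewrite i1 (leq_trans i2).
  rewrite big_split /= -mulr_sumr lerD2l.
  apply: le_trans (_ : \sum_(1 <= j < J.+1) (4 * harmonic R (4 * t) / j%:R
     + (2 / j%:R + 2 / (a - j)%N%:R)) <= _).
    apply: le_trans (sum_blocks_le (J := J) _ qX _) _.
    - exact: block_weight_ge0.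
    - by rewrite {1}XE ltn_ceil.
    - by apply: ler_sum_nat => j /andP[j1 j2]; apply: sum_block_weight.
  rewrite !big_split /= -!mulr_sumr -/(harmonic R J) -addrA.
  rewrite lerD2l lerD2l ler_wpM2l //.
  by apply: le_trans (sum_inv_sub R Ja) (harmonic_mono R Ja).
have -> : \sum_(q <= i < X | (q %| i)%N) excess alpha t i =
    \sum_(1 <= j < J.+1) excess alpha t (j * q)%N.
  rewrite -sum_multiples // -XE [RHS](@big_cat_nat _ _ _ q) //=.
  rewrite [X in _ = X + _]big_nat_cond [X in _ = X + _]big1 ?add0r // => i.
  by move=> /andP[/andP[i1 i2] dv]; have := dvdn_leq i1 dv; rewrite leqNgt i2.
set T := \sum_(1 <= j < J.+1) excess _ _ _.
have Tbound : `|T - a%:R * \sum_(1 <= j < J.+1) (j%:R ^+ 2)^-1| <= 5 + 5 * harmonic R J.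
  rewrite /T mulr_sumr -sumrB.
  apply: le_trans (ler_norm_sum _ _ _) _.
  apply: le_trans (_ : \sum_(1 <= j < J.+1) (2 * (j%:R ^+ 2)^-1 + 2 * j%:R^-1
     + 2 * ((cden alpha n.+2 - j)%N%:R)^-1 + (j%:R^-1 + t%:R^-1)) <= _).
    apply: ler_sum_nat => j /andP[j1 j2].
    have jJ : (j * q < cden alpha n.+2)%N.
      by apply: leq_ltn_trans JQ; rewrite leq_mul2r -ltnS j2 orbT.
    have B := special_term ia j1 jJ; rewrite -/q -/a in B.
    have jq0 : (0 < j * q)%N by rewrite muln_gt0 j1.
    have y0 := nearest_int_dist_gt0 ia jq0.
    have [u1 _] := near_sum_upper (j * q %/ t) y0.
    have g0 := near_sum_ge0 (j * q %/ t) ((j * q)%N%:R * alpha).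
    rewrite /excess; set G := near_sum _ _ in u1 g0 *.
    (* At a multiple the truncated part is small: [G] is at most one more than its number of
       layers. *)
    have gb : G / (j * q)%N%:R <= j%:R^-1 + t%:R^-1.
      rewrite ler_pdivrMr ?ltr0n // mulrDl.
      apply: le_trans u1 _; apply: lerD.
        by rewrite natrM mulKf ?ler1n // pnatr_eq0 -lt0n.
      by rewrite mulrC ler_pdivlMr ?ltr0n // -natrM ler_nat leq_trunc_div.
    have gp : 0 <= G / (j * q)%N%:R by rewrite divr_ge0.
    rewrite addrAC; apply: le_trans (ler_normB _ _) _.
    by rewrite [X in _ + X]ger0_norm // lerD.
  rewrite !big_split /= -!mulr_sumr -/(harmonic R J).
  have h1 := sum_inv_sq_le2 R J.
  have h2 : \sum_(1 <= j < J.+1) ((cden alpha n.+2 - j)%N%:R)^-1 <= harmonic R J.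
    by apply: sum_inv_sub; apply: leq_trans (ltnW JQ); rewrite leq_pmulr.
  (* The terms [1 / t] sum to at most 1 because [J <= a <= t]. *)
  have h3 : \sum_(1 <= j < J.+1) t%:R^-1 <= 1 :> R.
    rewrite sumr_const_nat subSS subn0 -[_ *+ J]mulr_natl ler_pdivrMr ?ltr0n // mul1r.
    by rewrite ler_nat (leq_trans Ja).
  set s1 := \sum_(_ <= _ < _) _ in h1 *.
  set s2 := \sum_(_ <= _ < _) _ in h2 *.
  set s3 := \sum_(_ <= _ < _) _ in h3 *.
  lra.
set V := a%:R * _ in Tbound *.
have -> : T + S - V = (T - V) + S by ring.
apply: le_trans (ler_normD _ _) _.
set u := \sum_(_ <= _ < _) _ in Sbound *.
lra.
Qed.

(** * Summing over the blocks *)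

Lemma complete_block_sum (R : realType) (alpha : R) n t : irrational alpha ->
  (cquot alpha n.+1 <= t)%N ->
  `| \sum_(cden alpha n.+1 <= i < cden alpha n.+2) excess alpha t i
     - pi ^+ 2 / 6 * (cquot alpha n.+1)%:R |
  <= 32 * (1 + ln t%:R) * harmonic R (cquot alpha n.+1)
     + 2 * \sum_(cden alpha n.+1 <= i < cden alpha n.+2) i%:R^-1.
Proof.
move=> ia at_; have q0 : (0 < cden alpha n.+1)%N by rewrite cden_gt0.
have a0 := cquot_gt0 n ia.
have Q0 : (0 < cden alpha n.+2)%N by rewrite cden_gt0.
have XQ : (cden alpha n.+1 <= cden alpha n.+2 <= cden alpha n.+2)%N by rewrite cden_leS //=.
have := block_sum ia at_ XQ.
set J := (_ %/ _)%N; set S := \sum_(_ <= _ < _) excess _ _ _.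
set V := \sum_(_ <= _ < _) (_ ^+ 2)^-1; set U := \sum_(_ <= _ < _) _ => B.
have QE := cdenSS n ia.
have aJ : (cquot alpha n.+1 <= J.+1)%N.
  rewrite -(leq_pmul2r q0); apply: leq_trans (_ : (cden alpha n.+2).-1.+1 <= _)%N.
    by rewrite prednK // QE leq_addr.
  by rewrite ltn_ceil.
have Ja : (J <= cquot alpha n.+1)%N.
  rewrite -ltnS ltn_divLR // prednK //; apply: leq_trans (_ : cden alpha n.+2 <= _)%N => //.
  by rewrite QE mulSn addnC leq_add2r cden_leS.
set a := cquot alpha n.+1 in a0 at_ B aJ Ja *.
have V0 : 0 <= V by apply: sumr_ge0 => i _; rewrite invr_ge0 sqr_ge0.
have tail : `| a%:R * V - pi ^+ 2 / 6 * a%:R | <= 2.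
  have -> : a%:R * V - pi ^+ 2 / 6 * a%:R = - (a%:R * (pi ^+ 2 / 6 - V)) by ring.
  rewrite normrN normrM normr_nat.
  (* [J] is [a] or [a - 1]. If [J = 0] then [a = 1] and the sum is empty, so [pi^2 / 6 <= 2] is
     required; otherwise the tail costs [a / J <= 2]. *)
  have [J0|J0] := posnP J.
    have a1 : a = 1%N by apply/eqP; rewrite eqn_leq a0 andbT -[1%N]/(0.+1)%N -J0.
    have := @basel_tail R 1 isT.
    have V00 : V = 0 by rewrite /V J0 big_geq.
    rewrite a1 V00 subr0 mul1r big_nat1 expr1n invr1 ler_norml.
    by move: (_ / 6) => u; lra.
  have /andP[b1 b2] := @basel_tail R J J0; rewrite -/V in b1 b2.
  rewrite (ger0_norm b1); apply: le_trans (ler_wpM2l (ler0n R a) b2) _.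
  rewrite ler_pdivrMr ?ltr0n // -natrM ler_nat.
  by apply: leq_trans aJ _; rewrite mul2n -addnn -addn1 leq_add2l.
have H4 := harmonic_4_le R (leq_trans a0 at_).
have Ha := @harmonic_ge1 R a a0; have HJ := harmonic_mono R Ja.
have HJ0 := harmonic_ge0 R J; have H40 := harmonic_ge0 R (4 * t).
have L0 := ln_nat_ge0 R t.
have -> : S - pi ^+ 2 / 6 * a%:R = (S - a%:R * V) + (a%:R * V - pi ^+ 2 / 6 * a%:R) by ring.
apply: le_trans (ler_normD _ _) _; apply: le_trans (lerD B tail) _.
(* The constant 32 is [5 + 23 + 2] from the block plus 2 from the tail, using that the harmonic sum
   of [a] is at least 1. *)
rewrite addrAC lerD2r.
have P1 : (7 + 4 * harmonic R (4 * t)) * harmonic R J <= (7 + 4 * (4 + ln t%:R)) * harmonic R a.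
  by apply: ler_pM; lra.
have P2 : ln t%:R <= ln t%:R * harmonic R a by rewrite ler_peMr.
move: P1 P2; set l := ln t%:R in L0 H4 *; set h := harmonic R a in Ha HJ *.
have P3 : 0 <= l * h by rewrite mulr_ge0 //; lra.
by move: ((7 + _) * harmonic R J) => w; lra.
Qed.

(** One truncation level [t] serves all blocks: each block asks only that its quotient be at most
    [t], and the sum of the quotients already is. *)
Lemma complete_blocks_sum (R : realType) (alpha : R) K t : irrational alpha ->
  (cquot_sum alpha K <= t)%N ->
  `| \sum_(1 <= i < cden alpha K.+1) excess alpha t i
     - pi ^+ 2 / 6 * (cquot_sum alpha K)%:R |
  <= 32 * (1 + ln t%:R) * \sum_(1 <= k < K.+1) harmonic R (cquot alpha k)
     + 2 * \sum_(1 <= i < cden alpha K.+1) i%:R^-1.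
Proof.
move=> ia; elim: K => [|K IH] st.
  by rewrite /cquot_sum !big_geq // !mulr0 subr0 normr0 addr0.
have sE : cquot_sum alpha K.+1 = (cquot_sum alpha K + cquot alpha K.+1)%N.
  by rewrite /cquot_sum big_nat_recr.
rewrite sE in st.
have {}IH := IH (leq_trans (leq_addr _ _) st).
have B := complete_block_sum ia (leq_trans (leq_addl _ _) st).
rewrite !(@big_cat_nat _ _ _ (cden alpha K.+1) 1 (cden alpha K.+2)) ?cden_gt0 ?cden_leS //=.
rewrite (@big_nat_recr _ _ _ K.+1) //= sE natrD.
move: IH B; set s1 := \sum_(_ <= _ < _) _; set s2 := \sum_(_ <= _ < _) _; 
  set s3 := \sum_(_ <= _ < _) _; set s4 := \sum_(_ <= _ < _) _ ; set s5 := \sum_(_ <= _ < _) _.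
move=> IH B.
have -> : s1 + s4 - pi ^+ 2 / 6 * ((cquot_sum alpha K)%:R + (cquot alpha K.+1)%:R) =
  (s1 - pi ^+ 2 / 6 * (cquot_sum alpha K)%:R) + (s4 - pi ^+ 2 / 6 * (cquot alpha K.+1)%:R) by ring.
by apply: le_trans (ler_normD _ _) _; lra.
Qed.

(** * Logarithmic bounds and the final estimate *)

Lemma log_err_ge1 (R : realType) (x : R) : 1 <= log_err x.
Proof.
rewrite /log_err -[leLHS](@expRK R) ler_ln ?posrE ?expR_gt0 //.
  by rewrite le_max lexx.
by rewrite lt_max expR_gt0.
Qed.

Lemma ln_le_log_err (R : realType) (x : R) : ln x <= log_err x.
Proof.
have [x0|x0] := leP x 0; first by rewrite ln0 // (le_trans ler01) // log_err_ge1.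
by rewrite /log_err ler_ln ?posrE // ?lt_max ?x0 ?orbT // le_max lexx orbT.
Qed.

(** Denominators at least double every two steps, and [ln 2 >= 1 / 2], so two steps raise the right
    side by at least 2. *)
Lemma index_le_ln_cden (R : realType) (alpha : R) K : irrational alpha ->
  K%:R <= 1 + 4 * ln (cden alpha K.+1)%:R :> R.
Proof.
move=> ia; suff [] : K%:R <= 1 + 4 * ln (cden alpha K.+1)%:R :> R /\
  K.+1%:R <= 1 + 4 * ln (cden alpha K.+2)%:R :> R by [].
elim: K => [|K [IH1 IH2]].
  have h1 := ln_nat_ge0 R (cden alpha 1); have h2 := ln_nat_ge0 R (cden alpha 2).
  by split; lra.
split=> //.
have q0 := cden_gt0 K ia.
have h1 := @ln_nat_mono R _ _ (cden_fib K.+1 ia).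
rewrite natrM lnM ?posrE ?ltr0n // in h1.
have /andP[h2 _] := @ln_succ_bounds R 1 isT; rewrite ln1 subr0 in h2.
have -> : K.+2%:R = K%:R + 2 :> R by rewrite -addn2 natrD.
by move: h1 h2 IH1; move: (ln _) (ln _) (ln _) => x y z; lra.
Qed.

(** Harmonic sums are at most [1 + ln a_k]; the logarithms add up to that of the product of the
    quotients, which is at most [q_K]. The error of all complete blocks is thereby
    [O(log t log N)]. *)
Lemma sum_harmonic_cquot (R : realType) (alpha : R) K : irrational alpha ->
  \sum_(1 <= k < K.+1) harmonic R (cquot alpha k) <= 1 + 5 * ln (cden alpha K.+1)%:R.
Proof.
move=> ia.
have prod_gt0 m : (0 < \prod_(1 <= k < m.+1) cquot alpha k)%N.
  by rewrite big_nat prodn_cond_gt0 // => -[|k] //= _; apply: cquot_gt0.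
have h1 : \sum_(1 <= k < K.+1) harmonic R (cquot alpha k)
    <= K%:R + ln (\prod_(1 <= k < K.+1) cquot alpha k)%N%:R.
  elim: K => [|K IH]; first by rewrite !big_geq // ln1 addr0.
  rewrite big_nat_recr //=.
  have -> : (\prod_(1 <= k < K.+2) cquot alpha k =
    \prod_(1 <= k < K.+1) cquot alpha k * cquot alpha K.+1)%N by rewrite big_nat_recr.
  rewrite natrM.
  rewrite lnM ?posrE ?ltr0n ?cquot_gt0 //.
  have h := harmonic_le_ln R (cquot_gt0 K ia).
  rewrite -natr1; move: IH h; move: (ln _) (ln _) => x y; lra.
have h2 := @ln_nat_mono R _ _ (prod_cquot_le K ia).
have h3 := index_le_ln_cden K ia.
lra.
Qed.

Lemma sum_partial_quotientsE (R : realType) (alpha : R) K : irrational alpha ->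
  (sum_partial_quotients alpha K)%:~R = (cquot_sum alpha K)%:R :> R.
Proof.
move=> ia; rewrite pmulrn; congr (_%:~R).
rewrite /sum_partial_quotients /cquot_sum; elim: K => [|K IH]; first by rewrite !big_geq.
rewrite big_nat_recr //= IH cquotE // -PoszD; congr Posz.
by rewrite [RHS]big_nat_recr.
Qed.

Theorem theorem4 (R : realType) :
  exists C : R, 0 < C /\
  forall (alpha : R) (K N : nat),
    irrational alpha ->
    (convergent_den alpha K <= N < convergent_den alpha K.+1)%N ->
    `| \sum_(1 <= n < N.+1) (n%:R * nearest_int_dist (n%:R * alpha))^-1
       - (ln (N%:R : R) ^+ 2
          + pi ^+ 2 / 6 * (sum_partial_quotients alpha K)%:~R
          + (partial_quotient alpha K.+1)%:~R
            * \sum_(1 <= j < (N %/ convergent_den alpha K).+1)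
                (j%:R ^+ 2)^-1) |
    <= C * (\sum_(1 <= k < K.+2)
               Num.sqrt (partial_quotient alpha k)%:~R
               * log_err (partial_quotient alpha k)%:~R
            + log_err (sum_partial_quotients alpha K.+1)%:~R
              * log_err N%:R).
Proof.
(* The error constants add up to less than 600: 64 from the truncated sum, 384 from the complete
   blocks, and about 105 from the last block and the leftover harmonic sum. *)
exists 600; split; first by rewrite ltr0n.
move=> alpha K N ia; rewrite !convergent_denE // => /andP[qN NQ].
rewrite !sum_partial_quotientsE // cquotE // -pmulrn.
set s := cquot_sum alpha K; set t := cquot_sum alpha K.+1.
have q0 := cden_gt0 K ia; have a0 := cquot_gt0 K ia.
have N0 : (0 < N)%N by apply: leq_trans qN.
have tE : t = (s + cquot alpha K.+1)%N by rewrite /t /cquot_sum big_nat_recr.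
have at_ : (cquot alpha K.+1 <= t)%N by rewrite tE leq_addl.
have st : (s <= t)%N by rewrite tE leq_addr.
have t0 : (0 < t)%N by apply: leq_trans at_.
have qX : (cden alpha K.+1 <= N.+1 <= cden alpha K.+2)%N by rewrite leqW.
have J1 : (N %/ cden alpha K.+1 <= N)%N by rewrite leq_div.
have B1 := near_sum_average ia N0 NQ t0.
have B2 := complete_blocks_sum ia st.
have B3 := block_sum ia at_ qX; rewrite [N.+1.-1]/= in B3.
have sqrt_ge0 : 0 <= \sum_(1 <= k < K.+2) Num.sqrt (partial_quotient alpha k)%:~R
    * log_err (partial_quotient alpha k)%:~R :> R.
  by apply: sumr_ge0 => k _; rewrite mulr_ge0 ?sqrtr_ge0 // (le_trans ler01) ?log_err_ge1.
(* Each summand is its truncation plus its excess; the excess is split at [q_K] into complete blocks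
   and the last, partial one. *)
have split_sum : \sum_(1 <= n < N.+1) (n%:R * nearest_int_dist (n%:R * alpha))^-1 =
    \sum_(1 <= n < N.+1) near_sum (n %/ t) (n%:R * alpha) / n%:R +
    (\sum_(1 <= i < cden alpha K.+1) excess alpha t i +
     \sum_(cden alpha K.+1 <= i < N.+1) excess alpha t i).
  rewrite -big_cat_nat ?leqW // -big_split /=; apply: eq_bigr => n _.
  by rewrite /excess addrC subrK.
have harm_split : \sum_(1 <= i < cden alpha K.+1) i%:R^-1 +
    \sum_(cden alpha K.+1 <= i < N.+1) i%:R^-1 = harmonic R N.
  by rewrite -big_cat_nat ?leqW.
have H1 := sum_harmonic_cquot K ia; have H1l := @ln_nat_mono R _ _ qN.
have HN := harmonic_le_ln R N0; have HJ := harmonic_mono R J1.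
have Ha := harmonic_le_ln R a0; have Hal := @ln_nat_mono R _ _ at_.
have H4 := harmonic_4_le R t0.
have H40 := harmonic_ge0 R (4 * t).
have LN1 := log_err_ge1 (N%:R : R); have LNl := ln_le_log_err (N%:R : R).
have Lt1 := log_err_ge1 (t%:R : R); have Ltl := ln_le_log_err (t%:R : R).
have lt0 := ln_nat_ge0 R t; have lN0 := ln_nat_ge0 R N.
have HN0 := harmonic_ge0 R N; have HJ0 := harmonic_ge0 R (N %/ cden alpha K.+1).
have HS0 : 0 <= \sum_(1 <= k < K.+1) harmonic R (cquot alpha k).
  by apply: sumr_ge0 => k _; apply: harmonic_ge0.
rewrite split_sum.
move: B1 B2 B3 harm_split H1.
set G := \sum_(_ <= _ < _) (near_sum _ _ / _).
set E1 := \sum_(_ <= _ < _) excess _ _ _; set E2 := \sum_(_ <= _ < _) excess _ _ _.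
set V := _ * \sum_(_ <= _ < _) (_ ^+ 2)^-1.
set h1 := \sum_(_ <= _ < _) _^-1; set h2 := \sum_(_ <= _ < _) _^-1.
set HS := \sum_(_ <= _ < _) harmonic _ _ in HS0 *.
set W := \sum_(_ <= _ < _) _ in sqrt_ge0 *.
move=> B1 B2 B3 harm_split H1.
have -> : G + (E1 + E2) - (ln N%:R ^+ 2 + pi ^+ 2 / 6 * s%:R + V) =
  (G - ln N%:R ^+ 2) + (E1 - pi ^+ 2 / 6 * s%:R) + (E2 - V) by ring.
apply: le_trans (ler_normD _ _) _.
apply: le_trans (lerD (ler_normD _ _) (lexx _)) _.
apply: le_trans (lerD (lerD B1 B2) B3) _.
set lN := ln N%:R in H1l HN LNl lN0 *; set lt := ln t%:R in Hal H4 Ltl lt0 *.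
set LN := log_err N%:R in LN1 LNl *; set Lt := log_err t%:R in Lt1 Ltl *.
set HJJ := harmonic R (N %/ _) in HJ HJ0 *.
set H4t := harmonic R (4 * t) in H4 H40 *; set HNN := harmonic R N in HN HJ HN0 harm_split *.
(* From here on each error is compared with a multiple of [Lt * LN], both factors being at least
   1. *)
have X1 : (1 + lt) * HNN <= (2 * Lt) * (2 * LN) by apply: ler_pM; lra.
have X2 : (1 + lt) * HS <= (2 * Lt) * (6 * LN) by apply: ler_pM; lra.
have X3 : (7 + 4 * H4t) * HJJ <= (23 + 4 * lt) * HNN by apply: ler_pM; lra.
have X6 : 0 <= lt * HNN by rewrite mulr_ge0.
have X4 : Lt <= Lt * LN by rewrite ler_peMr //; lra.
have X5 : LN <= Lt * LN by rewrite ler_peMl //; lra.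
lra.
Qed.
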